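(* Let $\rho>0$ and let $\varepsilon>0$ be a privacy parameter with $\varepsilon^{-1}=o(\log^{1/4} n)$. There is an $\varepsilon$-edge differentially private $(1+\rho)$-approximation algorithm for estimating the average degree $\bar d_G\ge 1$ of a graph $G$ on $n$ vertices, which runs in time $O\!\left(\sqrt{n}\cdot \mathrm{poly}(\log(n)/\rho)\cdot \mathrm{poly}(1/\varepsilon)\right)$.
   Context: Graphs are simple and undirected, $G=(V,E)$ with $|V|=n$, and $\bar d_G=\frac{1}{n}\sum_{v\in V}\deg(v)$. Access model (neighbor-query model): in constant time the algorithm may ask for $\deg(v)$ of any $v\in V$ (degree query), or for the identity of the $i$-th neighbor of $v$ (returning $\perp$ if $i>\deg(v)$). Running time and number of queries are used interchangeably. A $(1+\rho)$-approximation algorithm outputs a value $\tilde d$ such that with high probability $(1-\rho)\bar d_G\le \tilde d\le (1+\rho)\bar d_G$. Two graphs $G_1=(V,E_1)$, $G_2=(V,E_2)$ on the same vertex set are edge-neighboring if there is an edge $e$ with $E_1\setminus\{e\}=E_2\setminus\{e\}$. A randomized algorithm $\mathcal A$ is $\varepsilon$-edge differentially private if for every pair of edge-neighboring $n$-vertex graphs $G_1,G_2$ and every set $\mathcal S$ of outputs, $\Pr[\mathcal A(G_1)\in\mathcal S]\le e^{\varepsilon}\Pr[\mathcal A(G_2)\in\mathcal S]$. *)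

(* Defs.v *)
From HB Require Import structures.
From mathcomp Require Import all_boot all_order all_algebra.
From mathcomp Require Import all_classical all_reals all_analysis.

Set Implicit Arguments.
Unset Strict Implicit.
Unset Printing Implicit Defensive.

Import Order.TTheory GRing.Theory Num.Theory.
Import numFieldNormedType.Exports.

Local Open Scope classical_set_scope.
Local Open Scope ring_scope.

Record sgraph (n : nat) := SGraph {
  edges : {set {set 'I_n}} ;
  edges_card : forall e, e \in edges -> #|e| = 2%N }.

Definition nbhd (n : nat) (G : sgraph n) (v : 'I_n) : {set 'I_n} :=
  [set u | [set v; u]%SET \in edges G]%SET.

Definition deg (n : nat) (G : sgraph n) (v : 'I_n) : nat := #|nbhd G v|.

Definition avg_degree (R : realType) (n : nat) (G : sgraph n) : R :=
  (\sum_(v < n) (deg G v)%:R) / n%:R.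

Definition edge_neighboring (n : nat) (G1 G2 : sgraph n) : Prop :=
  exists2 e : {set 'I_n}, #|e| = 2%N &
    (edges G1 :\ e = edges G2 :\ e)%SET.

(* The query model does not say in which order the neighbors of a vertex are
   numbered.  A numbering is therefore kept as a parameter: it attaches to each
   graph and each vertex a duplicate-free list of the neighbors.  Algorithms
   are not allowed to depend on it, and their guarantees are required for all
   numberings. *)
Definition adj_lists (n : nat) (G : sgraph n) (l : 'I_n -> seq 'I_n) : Prop :=
  forall v, uniq (l v) /\ l v =i nbhd G v.

Definition numbering (n : nat) (L : sgraph n -> 'I_n -> seq 'I_n) : Prop :=
  forall G, adj_lists G (L G).

(* Deterministic adaptive query algorithms, as decision trees.  Neighbors are
   numbered from 0 in [NbrQuery], so that the answer is [None] (for "bottom")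
   iff [deg v <= i]. *)
Inductive qtree (R : Type) (n : nat) : Type :=
  | Output of R
  | DegQuery of 'I_n & (nat -> qtree R n)
  | NbrQuery of 'I_n & nat & (option 'I_n -> qtree R n).

Fixpoint result (R : Type) (n : nat) (G : sgraph n) (l : 'I_n -> seq 'I_n)
    (t : qtree R n) : R :=
  match t with
  | Output d => d
  | DegQuery v k => result G l (k (deg G v))
  | NbrQuery v i k => result G l (k (onth (l v) i))
  end.

Fixpoint nqueries (R : Type) (n : nat) (G : sgraph n) (l : 'I_n -> seq 'I_n)
    (t : qtree R n) : nat :=
  match t with
  | Output _ => 0
  | DegQuery v k => (nqueries G l (k (deg G v))).+1
  | NbrQuery v i k => (nqueries G l (k (onth (l v) i))).+1
  end.

(* A randomized algorithm is a random deterministic one: its coins are a point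
   of a probability space of its own, chosen independently of the input. *)
Record rand_alg (R : realType) (n : nat) := RandAlg {
  coin_disp : measure_display ;
  coins : measurableType coin_disp ;
  coin_law : probability coins R ;
  tree : coins -> qtree R n ;
  result_measurable : forall (G : sgraph n) (l : 'I_n -> seq 'I_n),
    adj_lists G l -> measurable_fun setT (fun w => result G l (tree w)) }.

Definition out_prob (R : realType) (n : nat) (A : rand_alg R n)
    (L : sgraph n -> 'I_n -> seq 'I_n) (G : sgraph n) (S : set R) : \bar R :=
  coin_law A [set w | S (result G (L G) (tree w))].

Definition edge_dp (R : realType) (n : nat) (eps : R) (A : rand_alg R n) :
    Prop :=
  forall L, numbering L -> forall G1 G2 : sgraph n, edge_neighboring G1 G2 ->
  forall S : set R, measurable S ->
    (out_prob A L G1 S <= (expR eps)%:E * out_prob A L G2 S)%E.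

(* "With high probability" means with probability 1 - o(1) as n tends to
   infinity, uniformly over the admissible inputs with n vertices. *)
Definition approximates_avg_degree (R : realType) (rho : R)
    (A : forall n, rand_alg R n) : Prop :=
  forall delta : R, 0 < delta ->
  \forall n \near \oo, forall L, numbering L ->
  forall G : sgraph n, 1 <= avg_degree R G ->
    ((1 - delta)%:E <= out_prob (A n) L G
      [set d : R | ((1 - rho) * avg_degree R G <= d <=
                    (1 + rho) * avg_degree R G)%R])%E.

Definition runs_within (R : realType) (n : nat) (A : rand_alg R n) (T : R) :
    Prop :=
  forall L, numbering L -> forall (G : sgraph n) (w : coins A),
    (nqueries G (L G) (tree w))%:R <= T.

(* Main.v *)
(* Estimator.  Write [d_v] for the degree of [v].  For a uniform vertex [v] and
   a uniform neighbour [u] of [v], the harmonic mean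
   [X = 2 d_v d_u / (d_v + d_u)] has expectation exactly the average degree (the
   weights [d_u / (d_v + d_u)] of the two orientations of an edge add up to 1),
   and its second moment, summed over the vertices, is at most [D^(3/2)] with
   [D = sum_v d_v].  So about [sqrt n] samples suffice.  The vertices are split
   into blocks of size [B] and one vertex is drawn in each block, so that no
   vertex is used twice.

   Sensitivity.  Passing from degree [b] to [b + 1] at one end multiplies [X] by
   at most [1 + 1/b], and at most [b] samples see that vertex as a neighbour.
   Hence changing one edge changes the sum of the truncated samples [min X T] by
   at most [4 T].

   Truncation.  The right [T] is of order [sqrt (n d)] with [d] the unknown
   average degree.  With [g = 1 + alpha], [T_a = tau g^a] and [Phi a] the
   estimate truncated at [T_a], the algorithm takes the largest [a] such that
   [Phi a >= g^(2 a)], i.e. a solution of [Phi = d] on a geometric grid.  Since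
   [Phi (a + 1) <= g Phi a], this index changes by at most 1 when an edge
   changes.  Adding discrete Laplace noise in a cyclic group to the index gives
   pure differential privacy, and a factor [g^(2 z)] close to 1 on the output.

   Since [rho] is fixed and [1/eps <= ln n] eventually, all parameters are
   chosen as powers of [ln n]; for small [n] the constant algorithm is used. *)

Require Import Defs.
From HB Require Import structures.
From mathcomp Require Import all_boot all_order all_algebra.
From mathcomp Require Import all_classical all_reals all_analysis.
From mathcomp Require Import ring lra zify.

Set Implicit Arguments.
Unset Strict Implicit.
Unset Printing Implicit Defensive.

Import Order.TTheory GRing.Theory Num.Theory.
Import numFieldNormedType.Exports.

Local Open Scope classical_set_scope.
Local Open Scope ring_scope.

(** * Coins drawn from a finite probability space *)

(** Measurable types are pointed, so the type carries its point [x0]. All subsets are measurable,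
    hence so is every function of the coins. *)
Definition discrete (T : Type) (x0 : T) : Type := T.

HB.instance Definition _ (T : choiceType) (x0 : T) :=
  Choice.on (discrete x0).

HB.instance Definition _ (T : choiceType) (x0 : T) :=
  isPointed.Build (discrete x0) x0.

HB.instance Definition _ (T : choiceType) (x0 : T) :=
  @isMeasurable.Build default_measure_display (discrete x0)
    discrete_measurable discrete_measurable0
    discrete_measurableC discrete_measurableU.

Section FiniteLaw.
Context (R : realType) (T : finType) (x0 : T) (p : T -> R).
Hypotheses (p_ge0 : forall w, 0 <= p w) (p_sum1 : \sum_w p w = 1).

(** [msum] adds measures indexed by [nat], so the point masses are listed through [enum_val], with
    the zero measure beyond [#|T|]. *)
Let atom (i : nat) : {measure set (discrete x0) -> \bar R} :=
  if insub i is Some i' then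
    mscale (NngNum (p_ge0 (enum_val (i' : 'I_#|T|))))
      (@dirac _ (discrete x0) (enum_val i' : discrete x0) R)
  else mzero.

Definition finite_law : set (discrete x0) -> \bar R := msum atom #|T|.

HB.instance Definition _ := Measure.on finite_law.

Lemma finite_lawE (S : set T) :
  finite_law S = (\sum_w p w * (w \in S)%:R)%:E.
Proof.
rewrite /finite_law /msum (reindex (@enum_val T T)) /=; last first.
  by apply: onW_bij; exact: enum_val_bij.
rewrite -sumEFin; apply: eq_bigr => i _.
rewrite /atom; case: insubP => [j _ ij|]; last by rewrite ltn_ord.
have -> : j = i by apply: val_inj.
by rewrite EFinM -indicE.
Qed.

Let finite_law_setT : finite_law [set: discrete x0] = 1%E.
Proof.
rewrite finite_lawE; congr EFin; rewrite -[RHS]p_sum1.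
by apply: eq_bigr => w _; rewrite in_setT mulr1.
Qed.

HB.instance Definition _ :=
  Measure_isProbability.Build _ _ _ finite_law finite_law_setT.

Context (n : nat) (t : T -> qtree R n).

Let measurable_result (G : sgraph n) (l : 'I_n -> seq 'I_n) :
  adj_lists G l ->
  measurable_fun [set: discrete x0] (fun w => result G l (t w)).
Proof. by []. Qed.

Definition finite_alg : rand_alg R n :=
  @RandAlg R n _ (discrete x0) finite_law t measurable_result.

Lemma out_prob_finite_alg L G (S : set R) :
  out_prob finite_alg L G S =
  (\sum_w p w * (result G (L G) (t w) \in S)%:R)%:E.
Proof.
by rewrite /out_prob /= finite_lawE.
Qed.

End FiniteLaw.

(** * Degrees and harmonic means over edges *)

Section Graphs.
Context (R : realType) (n : nat).
Implicit Types (G : sgraph n) (u v : 'I_n).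

Lemma nbhd_sym G u v : (u \in nbhd G v) = (v \in nbhd G u).
Proof. by rewrite !inE finset.setUC. Qed.

Lemma nbhd_irrefl G v : v \notin nbhd G v.
Proof.
apply/negP; rewrite inE => /edges_card.
by rewrite finset.setUid cards1.
Qed.

Definition deg_sum G : R := \sum_(v < n) (deg G v)%:R.

Lemma sum_nbhd1 G v : \sum_(u in nbhd G v) 1 = (deg G v)%:R :> R.
Proof. by rewrite sumr_const. Qed.

Lemma exchange_nbhd G (f : 'I_n -> 'I_n -> R) :
  \sum_(v < n) \sum_(u in nbhd G v) f v u =
  \sum_(v < n) \sum_(u in nbhd G v) f u v.
Proof.
rewrite (exchange_big_dep xpredT) //=; apply: eq_bigr => v _.
by apply: eq_bigl => u; rewrite nbhd_sym.
Qed.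

Lemma deg_gt0 G u v : u \in nbhd G v -> (0 < deg G v)%N.
Proof. by move=> uv; rewrite /deg (cardD1 u) uv. Qed.

Definition harm (a b : nat) : R := 2 * a%:R * b%:R / (a%:R + b%:R).

Lemma harm_ge0 a b : 0 <= harm a b.
Proof. by rewrite /harm divr_ge0 // ?mulr_ge0 // addr_ge0. Qed.

(** The harmonic mean is at most the geometric mean; without denominators this reads
    [0 <= a * b * (a - b) ^+ 2]. *)
Lemma harm_sqr_le a b : harm a b ^+ 2 <= a%:R * b%:R.
Proof.
rewrite /harm; have a0 := ler0n R a; have b0 := ler0n R b.
have [->|ab] := eqVneq (a%:R + b%:R : R) 0.
  by rewrite invr0 mulr0 expr0n mulr_ge0.
have ab0 : 0 < a%:R + b%:R :> R by rewrite lt_def ab addr_ge0.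
rewrite expr_div_n ler_pdivrMr ?exprn_gt0 //.
have := mulr_ge0 (mulr_ge0 a0 b0) (sqr_ge0 (a%:R - b%:R : R)); nra.
Qed.

Lemma harmS_ge a b : harm a b <= harm a b.+1.
Proof.
rewrite /harm; case: a => [|a]; first by rewrite !mulr0 !mul0r.
have a0 : 0 < a.+1%:R :> R by rewrite ltr0n.
have b0 := ler0n R b; rewrite -[b.+1]addn1 natrD -subr_ge0.
move: a.+1%:R b%:R a0 b0 => x y x0 y0.
have -> : 2 * x * (y + 1) / (x + (y + 1)) - 2 * x * y / (x + y) =
    2 * x ^+ 2 / ((x + y) * (x + (y + 1))) by field; lra.
by rewrite divr_ge0 // ?mulr_ge0 //; nra.
Qed.

(** The numerator grows by exactly the factor [1 + 1/b], while the denominator only increases. *)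
Lemma harmS_le a b : (0 < b)%N -> harm a b.+1 <= (1 + b%:R^-1) * harm a b.
Proof.
rewrite /harm; case: a => [|a b_gt0]; first by rewrite !mulr0 !mul0r mulr0.
have a0 : 0 < a.+1%:R :> R by rewrite ltr0n.
have b0 : 0 < b%:R :> R by rewrite ltr0n.
rewrite -[b.+1]addn1 natrD; set x := a.+1%:R; set y := b%:R.
have -> : (1 + y^-1) * (2 * x * y / (x + y)) = 2 * x * (y + 1) / (x + y).
  by field; rewrite gt_eqF ?gt_eqF //; rewrite /x /y; lra.
rewrite ler_pM2l; last by rewrite /x /y; nra.
by rewrite lef_pV2 ?posrE /x /y; lra.
Qed.

(* Summed over the [b] neighbours of a vertex, this is at most [T]. *)
Lemma harm_capS a b T : (0 < b)%N -> 0 <= T ->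
  `|Num.min (harm a b) T - Num.min (harm a b.+1) T| <= T / b%:R.
Proof.
move=> b0 T0; have bp : 0 < b%:R :> R by rewrite ltr0n.
have h1 := harmS_ge a b; have h2 := harmS_le a b0.
have h3 := harm_ge0 a b; rewrite distrC ger0_norm; last first.
  by rewrite subr_ge0 le_min !ge_min h1 lexx orbT.
have bi : 0 < b%:R^-1 :> R by rewrite invr_gt0.
have Tb : 0 <= T / b%:R by rewrite divr_ge0 // ltW.
have m2 : Num.min (harm a b.+1) T <= T by rewrite ge_min lexx orbT.
have m1 : Num.min (harm a b.+1) T <= harm a b.+1 by rewrite ge_min lexx.
have [hT|hT] := leP (harm a b) T; last by lra.
have : b%:R^-1 * harm a b <= b%:R^-1 * T by rewrite ler_pM2l.
by rewrite [T / _]mulrC; lra.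
Qed.

Lemma harm_mean_sum G :
  \sum_(v < n) (\sum_(u in nbhd G v) harm (deg G v) (deg G u)) / (deg G v)%:R
  = deg_sum G.
Proof.
pose f v u : R := harm (deg G v) (deg G u) / (deg G v)%:R.
rewrite (eq_bigr (fun v => \sum_(u in nbhd G v) f v u)); last first.
  by move=> v _; rewrite mulr_suml.
set A := LHS.
(* Doubling pairs the two orientations of each edge, and [f v u + f u v = 2]. *)
suff : A + A = deg_sum G + deg_sum G by lra.
rewrite {2}/A exchange_nbhd /A -big_split /=.
have -> : deg_sum G + deg_sum G =
   \sum_(v < n) \sum_(u in nbhd G v) (2 : R).
  rewrite /deg_sum -big_split /=; apply: eq_bigr => v _.
  by rewrite sumr_const /deg -mulr_natr; ring.
apply: eq_bigr => v _; rewrite -big_split /=; apply: eq_bigr => u uv.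
have dv : 0 < (deg G v)%:R :> R by rewrite ltr0n (deg_gt0 uv).
have du : 0 < (deg G u)%:R :> R.
  by rewrite ltr0n (@deg_gt0 _ v) // nbhd_sym.
by rewrite /f /harm; field; rewrite !gt_eqF //; lra.
Qed.

(* Symmetrizing over the two orientations of an edge turns the second moment
   into the sum of the harmonic means; Cauchy-Schwarz, in the form of AM-GM with
   weight [(deg_sum G)^(1/2)], does the rest. *)
Lemma harm_sqr_mean_sum G :
  \sum_(v < n)
    (\sum_(u in nbhd G v) harm (deg G v) (deg G u) ^+ 2) / (deg G v)%:R
  <= deg_sum G * Num.sqrt (deg_sum G).
Proof.
pose f v u : R := harm (deg G v) (deg G u) ^+ 2 / (deg G v)%:R.
rewrite (eq_bigr (fun v => \sum_(u in nbhd G v) f v u)); last first.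
  by move=> v _; rewrite mulr_suml.
set A := (X in X <= _).
have D0 : 0 <= deg_sum G by apply: sumr_ge0.
have [D00|Dn0] := eqVneq (deg_sum G) 0.
  rewrite D00 mul0r /A; apply: sumr_le0 => v _.
  have : (deg G v)%:R <= deg_sum G.
    by rewrite /deg_sum (bigD1 v) //= lerDl sumr_ge0.
  rewrite D00 => dv; apply: sumr_le0 => u uv.
  by have := deg_gt0 uv; rewrite -(ltr0n R) ltNge dv.
set s := Num.sqrt (deg_sum G).
have s0 : 0 < s by rewrite sqrtr_gt0 lt_def Dn0.
have s2 : deg_sum G = s ^+ 2 by rewrite sqr_sqrtr.
have two : A + A <= \sum_(v < n) \sum_(u in nbhd G v)
   (s^-1 * ((deg G v)%:R * (deg G u)%:R) + s).
  rewrite {2}/A exchange_nbhd /A -big_split /=.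
  apply: ler_sum => v _; rewrite -big_split /=; apply: ler_sum => u uv.
  have dv : 0 < (deg G v)%:R :> R by rewrite ltr0n (deg_gt0 uv).
  have du : 0 < (deg G u)%:R :> R.
    by rewrite ltr0n (@deg_gt0 _ v) // nbhd_sym.
  have -> : f v u + f u v = 2 * harm (deg G v) (deg G u).
    by rewrite /f /harm; field; rewrite !gt_eqF //; lra.
  have := harm_sqr_le (deg G v) (deg G u); set h := harm _ _ => h2.
  apply: (@le_trans _ _ (s^-1 * h ^+ 2 + s)); last first.
    by rewrite lerD2r ler_pM2l ?invr_gt0.
  rewrite -subr_ge0.
  have -> : s^-1 * h ^+ 2 + s - 2 * h = s^-1 * (h - s) ^+ 2.
    by field; rewrite gt_eqF.
  by rewrite mulr_ge0 ?sqr_ge0 // invr_ge0 ltW.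
suff : A + A <= 2 * (deg_sum G * s) by lra.
apply: (le_trans two).
rewrite (eq_bigr (fun v => s^-1 * (\sum_(u in nbhd G v)
    (deg G v)%:R * (deg G u)%:R) + s * (deg G v)%:R)); last first.
  move=> v _; rewrite big_split /= -mulr_sumr sumr_const /deg.
  by rewrite -[s *+ _]mulr_natr.
rewrite big_split /= -!mulr_sumr -/(deg_sum G).
have : \sum_(v < n) \sum_(u in nbhd G v) (deg G v)%:R * (deg G u)%:R
    <= deg_sum G ^+ 2.
  rewrite expr2 {1}/deg_sum mulr_suml; apply: ler_sum => v _.
  rewrite -mulr_sumr ler_wpM2l // /deg_sum.
  rewrite [leRHS](bigID (mem (nbhd G v))) /= lerDl.
  exact: sumr_ge0.
move=> le2; have : s^-1 * (\sum_(v < n) \sum_(u in nbhd G v)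
    (deg G v)%:R * (deg G u)%:R) <= s^-1 * deg_sum G ^+ 2.
  by rewrite ler_pM2l // invr_gt0.
have -> : s^-1 * deg_sum G ^+ 2 = deg_sum G * s.
  by rewrite s2; field; rewrite gt_eqF.
lra.
Qed.

End Graphs.

(** * Rearranging finite sums *)

Section Sums.
Context (R : realType).

Lemma sum_blocks (g : nat -> R) k B :
  \sum_(j < k) \sum_(x < B) g (j * B + x)%N = \sum_(v < k * B) g v.
Proof.
elim: k => [|k IH]; first by rewrite mul0n !big_ord0.
rewrite big_ord_recr IH /= -!(big_mkord xpredT g) mulSn addnC.
rewrite [RHS](@big_cat_nat _ _ _ (k * B)) ?leq_addr //=; congr (_ + _).
rewrite -[X in index_iota X _]add0n big_addn addKn big_mkord.
by apply: eq_bigr => i _; rewrite addnC.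
Qed.

(** Every residue is hit [K %/ d] times: [r %% d] is uniform when [r] is uniform below [K]. *)
Lemma sum_modn (g : nat -> R) d K : (d %| K)%N -> (0 < d)%N ->
  \sum_(r < K) g (r %% d)%N = (K %/ d)%:R * \sum_(i < d) g i.
Proof.
move=> dK d0; rewrite -(big_mkord xpredT (fun r => g (r %% d)%N)).
rewrite -{1}(divnK dK) big_mkord -(sum_blocks (fun r => g (r %% d)%N)).
rewrite mulr_natl -[X in _ *+ X]card_ord -sumr_const; apply: eq_bigr => j _.
by apply: eq_bigr => i _; rewrite modnMDl modn_small.
Qed.

Lemma sum_insub n (g : 'I_n -> R) m : (n <= m)%N ->
  \sum_(i < m) (if insub (i : nat) is Some v then g v else 0) =
  \sum_(v < n) g v.
Proof.
move=> nm; pose h i := if insub i is Some v then g v else 0.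
rewrite -(big_mkord xpredT h) (@big_cat_nat _ _ _ n) //=.
rewrite [X in _ + X]big_nat_cond [X in _ + X]big1 ?addr0; last first.
  by move=> i; rewrite andbT => /andP[ni _]; rewrite /h insubF // ltnNge ni.
by rewrite big_mkord; apply: eq_bigr => v _; rewrite /h valK.
Qed.

End Sums.

(** * Chebyshev's inequality for independent uniform coordinates *)

Section Chebyshev.
Context (R : realType) (I T : finType) (t0 : T).

(** Expectation under the uniform law on [W]. *)
Definition uexp (W : finType) (f : W -> R) : R := (\sum_w f w) / #|W|%:R.

Lemma card_gt0R (W : finType) (w : W) : 0 < #|W|%:R :> R.
Proof. by rewrite ltr0n; apply/card_gt0P; exists w. Qed.

Let Om := {ffun I -> T}.
Let om0 : Om := [ffun=> t0].

(** Independence of the coordinates of a uniform function. The next two lemmas use it with the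
    constant 1 at all coordinates but one or two. *)
Lemma ffun_sum_prod (F : I -> T -> R) :
  \sum_(c : Om) \prod_i F i (c i) = \prod_i \sum_t F i t.
Proof. by rewrite (@bigA_distr_bigA _ 0 1 *%R +%R). Qed.

Lemma uexp_coord (f : T -> R) i : uexp (fun c : Om => f (c i)) = uexp f.
Proof.
have := ffun_sum_prod (fun j t => if j == i then f t else 1).
rewrite (eq_bigr (fun c : Om => f (c i))); last first.
  move=> c _; rewrite (bigD1 i) //= eqxx big1 ?mulr1 // => j.
  by move=> /negbTE ->.
rewrite /uexp => ->; rewrite card_ffun (bigD1 i) //= eqxx.
rewrite [\prod_(_ | _) _](eq_bigr (fun=> #|T|%:R)); last first.
  by move=> j /negbTE ->; rewrite sumr_const.
rewrite prodr_const -[#|_|]/#|predC1 i| cardC1.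
have T0 := card_gt0R t0.
have I0 : (0 < #|I|)%N by apply/card_gt0P; exists i.
rewrite -{2}(prednK I0) natrX exprS invfM mulrACA divff ?mulr1 //.
by rewrite expf_neq0 // gt_eqF.
Qed.

Lemma uexp_cross (f g : T -> R) i j : i != j -> \sum_t f t = 0 ->
  \sum_(c : Om) f (c i) * g (c j) = 0.
Proof.
move=> ij f0; have := ffun_sum_prod
  (fun k t => if k == i then f t else if k == j then g t else 1).
rewrite [X in _ = X](bigD1 i) //= eqxx f0 mul0r => E.
rewrite -[RHS]E; apply: eq_bigr => c _.
rewrite (bigD1 i) //= eqxx; congr (_ * _).
have /negbTE ji : j != i by rewrite eq_sym.
rewrite (bigD1 j) /= ?ji // eqxx big1 ?mulr1 //.
by move=> k /andP[/negbTE -> /negbTE ->].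
Qed.

(** The cross terms of the centred summands [H] vanish, so variances add; each variance is at most
    the second moment, which is what the graph estimates control. *)
Lemma chebyshev_sum (F : I -> T -> R) (lam : R) : 0 < lam ->
  uexp (fun c : Om =>
    (lam <= `|\sum_i F i (c i) - \sum_i uexp (F i)|)%R%:R) <=
  (\sum_i uexp (fun t => F i t ^+ 2)) / lam ^+ 2.
Proof.
move=> lam0; pose H i t := F i t - uexp (F i).
have T0 := card_gt0R t0; have W0 := card_gt0R om0.
have H0 i : \sum_t H i t = 0.
  rewrite /H sumrB sumr_const -mulr_natr /uexp divfK ?subrr //.
  by rewrite gt_eqF.
have HF i : uexp (fun t => H i t ^+ 2) <= uexp (fun t => F i t ^+ 2).
  rewrite /uexp ler_pM2r ?invr_gt0 //.
  have E : \sum_t F i t = uexp (F i) * #|T|%:R.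
    by rewrite /uexp divfK // gt_eqF.
  rewrite (eq_bigr (fun t => F i t ^+ 2 + ((- 2 * uexp (F i)) * F i t
     + uexp (F i) ^+ 2))); last by move=> t _; rewrite /H; ring.
  rewrite big_split /= gerDl big_split /= -mulr_sumr E sumr_const -mulr_natr.
  by have := sqr_ge0 (uexp (F i)); nra.
pose Q (c : Om) := \sum_i H i (c i).
have QE (c : Om) : \sum_i F i (c i) - \sum_i uexp (F i) = Q c.
  by rewrite /Q sumrB.
have Q2 : uexp (fun c : Om => Q c ^+ 2) = \sum_i uexp (fun t => H i t ^+ 2).
  rewrite (eq_bigr (fun i => uexp (fun c : Om => H i (c i) ^+ 2))); last first.
    by move=> i _; rewrite (uexp_coord (fun t => H i t ^+ 2)).
  rewrite /uexp -mulr_suml; congr (_ / _).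
  rewrite (eq_bigr (fun c : Om => \sum_i \sum_j H i (c i) * H j (c j)));
    last first.
    move=> c _; rewrite expr2 /Q mulr_suml; apply: eq_bigr => i _.
    by rewrite mulr_sumr.
  rewrite exchange_big /=; apply: eq_bigr => i _.
  rewrite exchange_big /= (bigD1 i) //= [X in _ + X]big1 ?addr0.
    by apply: eq_bigr => c _; rewrite expr2.
  by move=> j ji; apply: uexp_cross; rewrite // eq_sym.
apply: (@le_trans _ _ (uexp (fun c : Om => Q c ^+ 2) / lam ^+ 2)).
  rewrite /uexp mulrAC ler_pM2r ?invr_gt0 // mulr_suml.
  apply: ler_sum => c _; rewrite QE.
  have [le|_] := leP lam `|Q c|; last by rewrite mulr0n divr_ge0 ?sqr_ge0.
  rewrite ler_pdivlMr ?exprn_gt0 // mul1r -[leRHS]real_normK ?num_real //.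
  by rewrite lerXn2r // nnegrE ?normr_ge0 // ltW.
by rewrite ler_pM2r ?invr_gt0 ?exprn_gt0 // Q2; apply: ler_sum => i _.
Qed.

End Chebyshev.

(** * Discrete Laplace noise on a cyclic group *)

Section CyclicNoise.
Context (R : realType) (m : nat) (eta : R).
Hypothesis eta_ge0 : 0 <= eta.
Implicit Types i z : 'I_m.+1.

(** Distance from [z] to 0 around the cycle of length [m.+1]. *)
Definition cyc_abs z : nat := minn z (m.+1 - z).

Definition noise_weight z : R := expR (- (eta * (cyc_abs z)%:R)).

Definition noise_pmf z : R := noise_weight z / \sum_i noise_weight i.

Lemma noise_total_ge1 : 1 <= \sum_z noise_weight z.
Proof.
rewrite (bigD1 ord0) //= {1}/noise_weight /cyc_abs min0n mulr0 oppr0 expR0.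
by rewrite lerDl sumr_ge0 // => i _; exact: expR_ge0.
Qed.

Lemma noise_pmf_ge0 z : 0 <= noise_pmf z.
Proof.
by rewrite divr_ge0 ?expR_ge0 // (le_trans ler01) // noise_total_ge1.
Qed.

Lemma noise_pmf_sum1 : \sum_z noise_pmf z = 1.
Proof.
rewrite -mulr_suml divff // gt_eqF //.
exact: lt_le_trans ltr01 noise_total_ge1.
Qed.

Lemma noise_weight_near z1 z2 :
  (cyc_abs z2 <= (cyc_abs z1).+1)%N ->
  noise_weight z1 <= expR eta * noise_weight z2.
Proof.
move=> le12; rewrite /noise_weight -expRD ler_expR.
have : (cyc_abs z2)%:R <= (cyc_abs z1)%:R + 1 :> R.
  by rewrite natr1 ler_nat.
by have := eta_ge0; nra.
Qed.

Lemma cyc_abs_inord z : cyc_abs (z + inord 1) = cyc_abs (inord (z.+1 %% m.+1)).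
Proof.
congr cyc_abs; apply: val_inj; rewrite [RHS]inordK ?ltn_pmod //=.
(* For [m = 0] the group is trivial and [inord 1] falls back to 0. *)
case: m z => [z|m' z]; first by rewrite !modn1.
by rewrite inordK // addn1.
Qed.

Lemma cyc_absD1 z : (cyc_abs (z + inord 1)%R <= (cyc_abs z).+1)%N /\
  (cyc_abs z <= (cyc_abs (z + inord 1)%R).+1)%N.
Proof.
rewrite cyc_abs_inord /cyc_abs inordK ?ltn_pmod //.
have := ltn_ord z; rewrite leq_eqVlt => /orP[/eqP E|lt].
  by rewrite E modnn min0n; lia.
by rewrite modn_small //; lia.
Qed.

Lemma noise_pmf_near z1 z2 :
  z1 = z2 \/ z1 = z2 + inord 1 \/ z2 = z1 + inord 1 ->
  noise_pmf z1 <= expR eta * noise_pmf z2.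
Proof.
move=> h; rewrite /noise_pmf mulrA ler_pM2r; last first.
  by rewrite invr_gt0 (lt_le_trans ltr01 noise_total_ge1).
apply: noise_weight_near.
case: h => [->|[->|->]]; [exact: leqnSn|exact: (cyc_absD1 z2).2|].
exact: (cyc_absD1 z1).1.
Qed.

(** Each of the [m.+1] points has mass at most [expR (- (eta * s))] if it lies beyond [s], since the
    normalizing sum is at least 1. *)
Lemma noise_tail s :
  \sum_(z | (s < cyc_abs z)%N) noise_pmf z <= m.+1%:R * expR (- (eta * s%:R)).
Proof.
apply: (@le_trans _ _ (\sum_(z : 'I_m.+1) expR (- (eta * s%:R)))); last first.
  by rewrite sumr_const card_ord mulr_natl.
rewrite [leRHS](bigID (fun z => s < cyc_abs z)%N) /= -[leLHS]addr0.
apply: lerD; last by apply: sumr_ge0 => i _; exact: expR_ge0.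
apply: ler_sum => z sz; rewrite /noise_pmf ler_pdivrMr; last first.
  exact: lt_le_trans ltr01 noise_total_ge1.
apply: (@le_trans _ _ (expR (- (eta * s%:R)))).
  rewrite ler_expR lerN2 ler_wpM2l // ler_nat; exact: ltnW.
by rewrite ler_peMr ?expR_ge0 // noise_total_ge1.
Qed.

(** In a group, [a + z = i] has the single solution [z = i - a]. So the two output laws compare
    point by point, through the masses at [i - a] and [i - b], which differ by at most one step; no
    boundary breaks the ratio. *)
Lemma noise_dp (a b : 'I_m.+1) (S : pred 'I_m.+1) :
  a = b \/ a = b + inord 1 \/ b = a + inord 1 ->
  \sum_z noise_pmf z * (S (a + z))%:R <=
  expR eta * \sum_z noise_pmf z * (S (b + z))%:R.
Proof.
move=> ab; rewrite mulr_sumr.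
have shift (c : 'I_m.+1) (F : 'I_m.+1 -> R) :
    \sum_z F z = \sum_i F (i - c).
  by rewrite (reindex_inj (addIr (- c))).
rewrite (shift a) [leRHS](shift b); apply: ler_sum => i _.
rewrite ![_ + (i - _)]addrC !subrK mulrA ler_wpM2r ?ler0n //.
apply: noise_pmf_near; case: ab => [->|[->|->]]; [by left| |].
  by right; right; rewrite opprD addrA addrNK.
by right; left; rewrite opprD addrA addrNK.
Qed.

End CyclicNoise.

(** * Sampling a vertex and a neighbour by queries *)

Section Probes.
Context (R : realType) (n : nat).
Implicit Types (G : sgraph n) (l : 'I_n -> seq 'I_n) (u v w : 'I_n).

(** An isolated vertex picks itself, by the default of [nth]; its harmonic mean is 0 in any case. *)
Definition pick G l v (r : nat) : 'I_n := nth v (l v) (r %% deg G v).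

(* The last block of vertices may overrun [n]: such indices give 0. *)
Definition obs G l (i r : nat) : R :=
  if insub i is Some v then harm R (deg G v) (deg G (pick G l v r)) else 0.

Lemma obs_ge0 G l i r : 0 <= obs G l i r.
Proof. by rewrite /obs; case: insub => // v; exact: harm_ge0. Qed.

Lemma obs_ord G l v r :
  obs G l v r = harm R (deg G v) (deg G (pick G l v r)).
Proof. by rewrite /obs valK. Qed.

Lemma harm0 b : harm R 0 b = 0.
Proof. by rewrite /harm mulr0 !mul0r. Qed.

Lemma size_adj_lists G l v : adj_lists G l -> size (l v) = deg G v.
Proof.
by move=> /(_ v)[/card_uniqP <- /eq_card e]; rewrite /deg e.
Qed.

Lemma pick_nbhd G l v r : adj_lists G l -> (0 < deg G v)%N ->
  pick G l v r \in nbhd G v.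
Proof.
move=> Gl d0; have [_ <-] := Gl v.
by rewrite mem_nth // (size_adj_lists v Gl) ltn_pmod.
Qed.

(** Since the index is reduced modulo [d], the answer [None] arises only for [d = 0], where [obs] is
    0 as well. *)
Definition probe (i r : nat) (k : R -> qtree R n) : qtree R n :=
  if insub i is Some v then
    DegQuery v (fun d =>
      NbrQuery v (r %% d) (fun o =>
        if o is Some u then DegQuery u (fun d' => k (harm R d d')) else k 0))
  else k 0.

Lemma result_probe G l i r k : adj_lists G l ->
  result G l (probe i r k) = result G l (k (obs G l i r)).
Proof.
move=> Gl; rewrite /probe /obs; case: insub => //= v.
case E: (onth _ _) => [u|] /=; first by rewrite /pick (@onth_nth _ _ _ _ _ E).
have := onthNE (l v) (r %% deg G v); rewrite E /= (size_adj_lists v Gl).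
case: (posnP (deg G v)) => [-> _|d0]; first by rewrite harm0.
by rewrite leqNgt ltn_pmod.
Qed.

Lemma nqueries_probe G l i r k : adj_lists G l ->
  (nqueries G l (probe i r k) <= nqueries G l (k (obs G l i r)) + 3)%N.
Proof.
move=> Gl; rewrite /probe /obs; case: insub => [v|] /=; last exact: leq_addr.
case E: (onth _ _) => [u|] /=.
  by rewrite /pick (@onth_nth _ _ _ _ _ E) addn3.
have := onthNE (l v) (r %% deg G v); rewrite E /= (size_adj_lists v Gl).
case: (posnP (deg G v)) => [-> _|d0]; first by rewrite harm0 addn3 ltnW.
by rewrite leqNgt ltn_pmod.
Qed.

Fixpoint probes (s : seq (nat * nat)) (fin : seq R -> R) : qtree R n :=
  if s is (i, r) :: s' then
    probe i r (fun x => probes s' (fun xs => fin (x :: xs)))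
  else Output n (fin [::]).

Lemma result_probes G l s fin : adj_lists G l ->
  result G l (probes s fin) = fin [seq obs G l p.1 p.2 | p <- s].
Proof.
move=> Gl; elim: s fin => [|[i r] s IH] fin //=.
by rewrite result_probe //= IH.
Qed.

Lemma nqueries_probes G l s fin : adj_lists G l ->
  (nqueries G l (probes s fin) <= 3 * size s)%N.
Proof.
move=> Gl; elim: s fin => [|[i r] s IH] fin //=.
apply: leq_trans (nqueries_probe _ _ _ Gl) _.
by rewrite mulnS addnC leq_add2l.
Qed.

(** The two graphs may number the same neighbourhood differently. The map [f] keeps the quotient
    [r %/ d] and permutes the residues so that both graphs pick the same neighbour. *)
Lemma pick_coupling G1 G2 l1 l2 v K :
  adj_lists G1 l1 -> adj_lists G2 l2 -> nbhd G1 v = nbhd G2 v ->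
  ((0 < deg G1 v)%N -> (deg G1 v %| K)%N) ->
  exists f : 'I_K -> 'I_K,
    injective f /\ forall r, pick G1 l1 v (f r) = pick G2 l2 v r.
Proof.
move=> Gl1 Gl2 N12; have d12 : deg G2 v = deg G1 v by rewrite /deg N12.
have s1 := size_adj_lists v Gl1; have s2 := size_adj_lists v Gl2.
rewrite d12 in s2; rewrite /pick d12.
set d := deg G1 v in s1 s2 *; move=> dK.
have [d0|d0] := posnP d.
  exists id; split=> // r.
  by rewrite d0 in s1 s2; rewrite (size0nil s1) (size0nil s2) !nth_nil.
(* Position in [l1 v] of the neighbour that [r] selects in [l2 v]. *)
pose ix r := index (nth v (l2 v) (r %% d)) (l1 v).
have in12 r : nth v (l2 v) (r %% d) \in l1 v.
  rewrite (Gl1 v).2 N12 -(Gl2 v).2 mem_nth // s2 ltn_pmod //.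
have ixd r : (ix r < d)%N by rewrite -s1 index_mem.
have fP (r : 'I_K) : (r %/ d * d + ix r < K)%N.
  apply: (@leq_trans ((r %/ d).+1 * d)).
    by rewrite mulSn addnC ltn_add2r.
  rewrite -[leqRHS](divnK (dK d0)) leq_mul2r; apply/orP; right.
  by rewrite ltn_divLR // divnK ?dK.
exists (fun r => Ordinal (fP r)); split=> [r1 r2 /(congr1 val) /= e|r] /=.
  have eq : (r1 %/ d = r2 %/ d)%N.
    have := congr1 (divn^~ d) e.
    by rewrite !divnMDl // !(divn_small (ixd _)) !addn0.
  have em : ix r1 = ix r2 by move/eqP: e; rewrite eq eqn_add2l => /eqP.
  apply: val_inj => /=; rewrite (divn_eq r1 d) (divn_eq r2 d) eq; congr addn.
  have := congr1 (nth v (l1 v)) em; rewrite !nth_index // => /eqP.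
  by rewrite nth_uniq ?s2 ?ltn_pmod ?(Gl2 v).1 // => /eqP.
by rewrite modnMDl modn_small // nth_index.
Qed.

End Probes.

(** * Effect of one edge on the truncated samples *)

Section Sensitivity.
Context (R : realType) (n : nat).
Implicit Types (G : sgraph n) (l : 'I_n -> seq 'I_n) (u v w : 'I_n).

(** What is kept of [G1] being [G2] with [e] possibly removed; equal graphs qualify, which covers
    neighboring graphs that coincide. *)
Definition subgraph_upto G1 G2 (e : {set 'I_n}) : Prop :=
  [/\ #|e| = 2%N, forall w, w \notin e -> nbhd G1 w = nbhd G2 w &
      forall x, x \in e -> (deg G1 x <= deg G2 x <= (deg G1 x).+1)%N].

Lemma edge_deletion_upto G1 G2 (e : {set 'I_n}) : #|e| = 2%N ->
  (edges G1 :\ e = edges G2 :\ e)%SET -> e \notin edges G1 ->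
  subgraph_upto G1 G2 e.
Proof.
move=> e2 E12 eG1; have mem f : f != e -> (f \in edges G1) = (f \in edges G2).
  move=> fe; have := congr1 (fun A : {set _} => f \in A) E12.
  by rewrite !inE fe.
split=> // [w we|x xe].
  apply/finset.setP => u; rewrite !inE mem //; apply: contraNneq we => <-.
  by rewrite !inE eqxx.
(* The only neighbour of [x] that [G2] can add is the other endpoint [y] of [e]. *)
have [y yP] : exists y, e :\ x = [set y]%SET.
  by apply/cards1P; have := cardsD1 x e; rewrite xe e2 => h; apply/eqP; lia.
apply/andP; split.
  apply: subset_leq_card; apply/fintype.subsetP => u; rewrite !inE => uG.
  by rewrite -mem //; apply: contraNneq eG1 => <-.
apply: (@leq_trans #|y |: nbhd G1 x|); last first.
  by rewrite cardsU1; case: (_ \notin _).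
apply: subset_leq_card; apply/fintype.subsetP => u; rewrite !inE => uG.
have [ue|ne] := eqVneq [set x; u]%SET e; last by rewrite mem ?uG ?orbT.
have : u \in (e :\ x)%SET.
  rewrite !inE -ue !inE eqxx orbT andbT; apply/negP => /eqP ux.
  by move: e2; rewrite -ue ux finset.setUid cards1.
by rewrite yP inE => ->.
Qed.

Definition sens_bound G (e : {set 'I_n}) (T : R) (i : nat) : R :=
  if insub i is Some w then
    \sum_(x in e) (T * (w == x)%:R + T / (deg G x)%:R * (w \in nbhd G x)%:R)
  else 0.

Lemma sens_bound_ge0 G e (T : R) i : 0 <= T -> 0 <= sens_bound G e T i.
Proof.
move=> T0; rewrite /sens_bound; case: insub => // w; apply: sumr_ge0 => x _.
by rewrite addr_ge0 ?mulr_ge0 ?invr_ge0 ?ler0n.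
Qed.

(** Each of the two endpoints costs [T] for itself and at most [deg G x] times [T / deg G x] through
    its neighbours. *)
Lemma sens_bound_sum G (e : {set 'I_n}) (T : R) m :
  0 <= T -> #|e| = 2%N -> (n <= m)%N ->
  \sum_(i < m) sens_bound G e T i <= 4 * T.
Proof.
move=> T0 e2 nm; rewrite sum_insub // exchange_big /=.
have -> : 4 * T = \sum_(x in e) (2 * T).
  by rewrite sumr_const e2 -mulr_natr; ring.
apply: ler_sum => x _; rewrite big_split /= -!mulr_sumr.
have -> : \sum_(w < n) (w == x)%:R = 1 :> R.
  by rewrite (bigD1 x) //= eqxx big1 ?addr0 // => w /negbTE ->.
have -> : \sum_(w < n) (w \in nbhd G x)%:R = (deg G x)%:R :> R.
  rewrite -sum_nbhd1 [RHS]big_mkcond; apply: eq_bigr => w _.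
  by case: (w \in _).
have [->|d0] := posnP (deg G x); first by rewrite mulr0; lra.
by rewrite divfK ?pnatr_eq0 ?lt0n_neq0 //; lra.
Qed.

Lemma cap_in (T x : R) : 0 <= x -> 0 <= T -> 0 <= Num.min x T <= T.
Proof. by move=> x0 T0; rewrite le_min x0 T0 ge_min lexx orbT. Qed.

(** At an endpoint both values lie in [[0, T]]. Elsewhere [v] keeps its degree and picks the same
    neighbour, so only the degree of that neighbour can change, and [harm_capS] applies. *)
Lemma obs_sens G1 G2 l1 l2 e (T : R) v r1 r2 :
  adj_lists G1 l1 -> subgraph_upto G1 G2 e -> 0 <= T ->
  (v \notin e -> pick G1 l1 v r1 = pick G2 l2 v r2) ->
  `|Num.min (obs R G1 l1 v r1) T - Num.min (obs R G2 l2 v r2) T|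
    <= sens_bound G1 e T v.
Proof.
move=> Gl1 [e2 Ne De] T0 pe.
have term_ge0 x :
    0 <= T * (v == x)%:R + T / (deg G1 x)%:R * (v \in nbhd G1 x)%:R.
  by rewrite addr_ge0 ?mulr_ge0 ?invr_ge0 ?ler0n.
have le_sens x : x \in e ->
    T * (v == x)%:R + T / (deg G1 x)%:R * (v \in nbhd G1 x)%:R
      <= sens_bound G1 e T v.
  by move=> xe; rewrite /sens_bound valK (bigD1 x) //= lerDl sumr_ge0.
have [ve|ve] := boolP (v \in e).
  apply: le_trans (le_sens _ ve); rewrite eqxx mulr1.
  have /andP[a1 a2] := cap_in (obs_ge0 R G1 l1 v r1) T0.
  have /andP[b1 b2] := cap_in (obs_ge0 R G2 l2 v r2) T0.
  have c0 : 0 <= T / (deg G1 v)%:R * (v \in nbhd G1 v)%:R.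
    by rewrite mulr_ge0 ?divr_ge0 ?ler0n.
  by rewrite ler_norml; lra.
rewrite !obs_ord -(pe ve); set u := pick G1 l1 v r1.
have -> : deg G2 v = deg G1 v by rewrite /deg Ne.
have [d0|d0] := posnP (deg G1 v).
  by rewrite d0 !harm0 subrr normr0 sens_bound_ge0.
have uv : u \in nbhd G1 v by exact: pick_nbhd.
have [ue|ue] := boolP (u \in e); last first.
  by rewrite /deg (Ne u) // subrr normr0 sens_bound_ge0.
apply: le_trans (le_sens _ ue); rewrite nbhd_sym uv mulr1.
have du : (0 < deg G1 u)%N by apply: (@deg_gt0 _ _ v); rewrite nbhd_sym.
have t0 : 0 <= T * (v == u)%:R by rewrite mulr_ge0.
have /andP[] := De _ ue; rewrite leq_eqVlt => /orP[/eqP <- _|lt le].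
  by rewrite subrr normr0 addr_ge0 // divr_ge0.
have -> : deg G2 u = (deg G1 u).+1 by apply/eqP; rewrite eqn_leq lt le.
have := harm_capS (deg G1 v) du T0; lra.
Qed.

End Sensitivity.

(** * The block estimator and its coupling *)

Section Estimator.
Context (R : realType) (n k B K : nat).
Hypotheses (nkB : (n <= k * B)%N)
  (dvdK : forall d, (0 < d)%N -> (d < n)%N -> (d %| K)%N).
Implicit Types (G : sgraph n) (l : 'I_n -> seq 'I_n).

(** For each block: the offset of the sampled vertex, and a number whose residue modulo the degree
    selects the neighbour. *)
Definition sampling := {ffun 'I_k -> 'I_B * 'I_K}.

Definition sample (c : sampling) (j : 'I_k) : nat * nat :=
  ((j * B + (c j).1)%N, (c j).2 : nat).

Definition est G l (T : R) (c : sampling) : R :=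
  \sum_j Num.min (obs R G l (sample c j).1 (sample c j).2) T.

Lemma deg_lt G v : (deg G v < n)%N.
Proof.
rewrite -[X in (_ < X)%N]card_ord /deg -[X in (_ < X)%N]cardsT.
apply: proper_card; apply/properP; split; first exact/fintype.subsetP.
by exists v; [rewrite inE|exact: nbhd_irrefl].
Qed.

Lemma est_sens G1 G2 l1 l2 e (T : R) (f : nat -> 'I_K -> 'I_K) (c : sampling) :
  adj_lists G1 l1 -> adj_lists G2 l2 ->
  subgraph_upto G1 G2 e \/ subgraph_upto G2 G1 e -> 0 <= T ->
  (forall v : 'I_n, v \notin e -> forall r,
     pick G1 l1 v (f v r) = pick G2 l2 v r) ->
  `|est G1 l1 T [ffun j => ((c j).1, f (j * B + (c j).1)%N (c j).2)]
    - est G2 l2 T c| <= 4 * T.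
Proof.
move=> Gl1 Gl2 sub T0 fP; rewrite /est -sumrB.
apply: le_trans (ler_norm_sum _ _ _) _.
suff [G e2 pt] : exists2 G, #|e| = 2%N & forall (v : 'I_n) r,
   `|Num.min (obs R G1 l1 v (f v r)) T - Num.min (obs R G2 l2 v r) T|
    <= sens_bound G e T v.
  (* One index is sampled per block; as the bound is nonnegative, it may be summed over the whole
     block, so each vertex counts once. *)
  apply: (@le_trans _ _ (\sum_(j < k) \sum_(x < B)
      sens_bound G e T (j * B + x)%N)); last first.
    by rewrite sum_blocks sens_bound_sum.
  apply: ler_sum => j _; rewrite /sample !ffunE /=.
  rewrite (bigD1 (c j).1) //= -[leLHS]addr0; apply: lerD; last first.
    by apply: sumr_ge0 => x _; exact: sens_bound_ge0.
  move: (c j).2 (j * B + (c j).1)%N => r i.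
  case: (insubP 'I_n i) => [v _ <-|nv]; first exact: pt.
  by rewrite /obs /sens_bound !insubN // subrr normr0.
case: sub => sub; [exists G1|exists G2]; try by case: sub.
  by move=> v r; apply: obs_sens => // ve; exact: fP.
move=> v r; rewrite distrC; apply: obs_sens => // ve.
by rewrite fP.
Qed.

(** An injection of a finite set into itself preserves the uniform law. Here [b] keeps the sampled
    vertices and permutes each neighbour index as in [pick_coupling], with the identity at the
    endpoints of [e]. *)
Lemma sampling_coupling G1 G2 l1 l2 :
  adj_lists G1 l1 -> adj_lists G2 l2 -> edge_neighboring G1 G2 ->
  exists2 b : sampling -> sampling, injective b &
    forall c T, 0 <= T -> `|est G1 l1 T (b c) - est G2 l2 T c| <= 4 * T.
Proof.
move=> Gl1 Gl2 [e e2 E12].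
have sub : subgraph_upto G1 G2 e \/ subgraph_upto G2 G1 e.
  have [eG1|eG1] := boolP (e \in edges G1); last first.
    by left; exact: edge_deletion_upto.
  have [eG2|eG2] := boolP (e \in edges G2); last first.
    by right; exact: edge_deletion_upto.
  have EE : edges G1 = edges G2.
    by rewrite -(finset.setD1K eG1) E12 finset.setD1K.
  have NN w : nbhd G1 w = nbhd G2 w by rewrite /nbhd EE.
  by left; split=> // x _; rewrite /deg NN leqnn leqnSn.
have NE w : w \notin e -> nbhd G1 w = nbhd G2 w.
  by case: sub => -[_ + _] we => [->|<-].
have fex (i : nat) : exists f : 'I_K -> 'I_K, injective f /\
    forall v : 'I_n, v = i :> nat -> v \notin e ->
      forall r, pick G1 l1 v (f r) = pick G2 l2 v r.
  case: (insubP 'I_n i) => [v _ vi|nv]; last first.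
    by exists id; split=> // v vi; rewrite -vi ltn_ord in nv.
  have [ve|ve] := boolP (v \in e).
    exists id; split=> // w wi; rewrite (_ : w = v) ?ve //.
    by apply: val_inj; rewrite /= wi.
  have [|f [fi fP]] := pick_coupling Gl1 Gl2 (NE v ve) (K := K).
    by move=> d0; apply: dvdK => //; exact: deg_lt.
  exists f; split=> // w wi _; rewrite (_ : w = v) //.
  by apply: val_inj; rewrite /= wi.
have [f fP] := choice fex.
exists (fun c : sampling =>
  [ffun j => ((c j).1, f (j * B + (c j).1)%N (c j).2)] : sampling).
  move=> c1 c2 /ffunP h; apply/ffunP => j; have := h j; rewrite !ffunE.
  case: (c1 j) (c2 j) => [x1 r1] [x2 r2] /= [-> ] /(fP _).1 -> //.
move=> c T T0; apply: (@est_sens _ _ _ _ e) => // v ve r.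
exact: ((fP v).2 v).
Qed.

End Estimator.

(** * Mean, second moment and concentration of the estimator *)

Section Moments.
Context (R : realType) (n k B K : nat).
Hypotheses (nkB : (n <= k * B)%N) (B_gt0 : (0 < B)%N) (K_gt0 : (0 < K)%N)
  (dvdK : forall d, (0 < d)%N -> (d < n)%N -> (d %| K)%N).
Context (G : sgraph n) (l : 'I_n -> seq 'I_n).
Hypothesis Gl : adj_lists G l.
Implicit Type phi : R -> R.
Local Notation D := (deg_sum R G).

Lemma sum_pick (F : 'I_n -> R) v : (0 < deg G v)%N ->
  \sum_(r < K) F (pick G l v r) =
  K%:R * ((\sum_(u in nbhd G v) F u) / (deg G v)%:R).
Proof.
move=> d0; have dK : (deg G v %| K)%N by apply: dvdK => //; exact: deg_lt.
rewrite /pick (sum_modn (fun i => F (nth v (l v) i)) dK d0).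
have -> : \sum_(i < deg G v) F (nth v (l v) i) = \sum_(u in nbhd G v) F u.
  rewrite -(size_adj_lists v Gl).
  rewrite -(big_mkord xpredT (fun i => F (nth v (l v) i))).
  rewrite -(big_nth v xpredT F) big_uniq ?(Gl v).1 //=.
  by apply: eq_bigl => u; rewrite (Gl v).2.
by rewrite natf_div // mulrAC mulrA.
Qed.

Definition probe_mean phi (j : 'I_k) : R :=
  uexp (fun t : 'I_B * 'I_K => phi (obs R G l (j * B + t.1) t.2)).

(** The blocks cover each vertex once, with probability [1 / B] in its block; indices beyond [n]
    contribute [phi 0]. *)
Lemma probe_mean_sum phi : phi 0 = 0 ->
  \sum_j probe_mean phi j =
  (\sum_(v < n) (\sum_(u in nbhd G v) phi (harm R (deg G v) (deg G u)))
     / (deg G v)%:R) / B%:R.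
Proof.
move=> phi0; pose g i := \sum_(r < K) phi (obs R G l i r).
have -> : \sum_j probe_mean phi j =
    (\sum_(j < k) \sum_(x < B) g (j * B + x)%N) / (B%:R * K%:R).
  rewrite mulr_suml; apply: eq_bigr => j _.
  rewrite /probe_mean /uexp card_prod !card_ord natrM; congr (_ / _).
  by rewrite (pair_bigA _ (fun (x : 'I_B) (r : 'I_K) =>
    phi (obs R G l (j * B + x) r))).
rewrite sum_blocks.
pose h v := \sum_(r < K) phi (harm R (deg G v) (deg G (pick G l v r))).
have -> : \sum_(i < k * B) g i = \sum_(v < n) h v.
  rewrite -(sum_insub h nkB); apply: eq_bigr => i _.
  rewrite /g /obs; case: insub => // ; rewrite big1 //.
have Bn0 : B%:R != 0 :> R by rewrite pnatr_eq0 -lt0n.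
have Kn0 : K%:R != 0 :> R by rewrite pnatr_eq0 -lt0n.
rewrite !mulr_suml; apply: eq_bigr => v _; rewrite /h.
have [d0|d0] := posnP (deg G v).
  rewrite d0 invr0 mulr0 mul0r big1 ?mul0r // => r _.
  by rewrite harm0.
rewrite (sum_pick (fun u => phi (harm R (deg G v) (deg G u)))) //.
by move: (_ / (deg G v)%:R) => y; field; rewrite Bn0 Kn0.
Qed.

Lemma probe_mean_id : \sum_j probe_mean id j = D / B%:R.
Proof. by rewrite probe_mean_sum // harm_mean_sum. Qed.

Lemma probe_mean_sqr :
  \sum_j probe_mean (fun x => x ^+ 2) j <= D * Num.sqrt D / B%:R.
Proof.
rewrite probe_mean_sum ?expr0n // ler_pM2r ?invr_gt0 ?ltr0n //.
exact: harm_sqr_mean_sum.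
Qed.

Lemma uexp_le (W : finType) (f g : W -> R) : (forall w, f w <= g w) ->
  uexp f <= uexp g.
Proof.
by move=> fg; rewrite /uexp ler_wpM2r ?invr_ge0 ?ler0n // ler_sum.
Qed.

(* [x - x^2 / (4 T) <= min x T] reduces the truncation bias to the second
   moment. *)
Lemma probe_mean_cap T : 0 < T ->
  D / B%:R - D * Num.sqrt D / B%:R / (4 * T) <=
  \sum_j probe_mean (fun x => Num.min x T) j.
Proof.
move=> T0; rewrite -probe_mean_id.
apply: (@le_trans _ _ (\sum_j probe_mean id j -
    (\sum_j probe_mean (fun x => x ^+ 2) j) / (4 * T))).
  rewrite lerB // ler_pM2r ?probe_mean_sqr // invr_gt0; lra.
rewrite mulr_suml -sumrB; apply: ler_sum => j _.
rewrite /probe_mean /uexp mulrAC -mulrBl mulr_suml -sumrB.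
apply: uexp_le => t; set x := obs _ _ _ _ _.
have x0 : 0 <= x by exact: obs_ge0.
have T4 : 0 < (4 * T)^-1 by rewrite invr_gt0; lra.
rewrite le_min; apply/andP; split.
  by rewrite gerBl mulr_ge0 ?sqr_ge0 // ltW.
rewrite -subr_ge0.
have -> : T - (x - x ^+ 2 / (4 * T)) = (x - 2 * T) ^+ 2 / (4 * T).
  by field; lra.
by rewrite mulr_ge0 ?sqr_ge0 // ltW.
Qed.

Definition usum phi (c : sampling k B K) : R :=
  \sum_j phi (obs R G l (sample c j).1 (sample c j).2).

(** Since [phi x <= x], one second-moment bound serves both the full samples and the truncated
    ones. *)
Lemma usum_concentration phi lam : 0 < lam ->
  (forall x, 0 <= x -> 0 <= phi x <= x) ->
  uexp (fun c => (lam <= `|usum phi c - \sum_j probe_mean phi j|)%R%:R)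
    <= D * Num.sqrt D / B%:R / lam ^+ 2.
Proof.
move=> lam0 phiP; pose t0 : 'I_B * 'I_K := (Ordinal B_gt0, Ordinal K_gt0).
have := chebyshev_sum t0
  (fun (j : 'I_k) (t : 'I_B * 'I_K) => phi (obs R G l (j * B + t.1) t.2)) lam0.
move=> /le_trans; apply.
rewrite ler_pM2r ?invr_gt0 ?exprn_gt0 //.
apply: le_trans probe_mean_sqr; apply: ler_sum => j _; apply: uexp_le => t.
have /andP[p0 px] := phiP _ (obs_ge0 R G l (j * B + t.1) t.2).
by rewrite lerXn2r ?nnegrE // obs_ge0.
Qed.

End Moments.

(** * The level selected on the geometric grid *)

Section Level.
Context (R : realType) (n : nat) (alpha : R).
Hypothesis alpha_ge0 : 0 <= alpha.
Local Notation g := (1 + alpha).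
Implicit Type Phi : nat -> R.

(** The maximum of an empty family is 0; this default is why [level_upper] asks for [1 <= M]. *)
Definition level Phi : nat :=
  \max_(a < n.+1 | (g ^+ a) ^+ 2 <= Phi a) a.

Lemma gX_ge1 a : 1 <= g ^+ a.
Proof. by apply: exprn_ege1; rewrite lerDl. Qed.

Lemma level_leq Phi : (level Phi <= n)%N.
Proof. by apply/bigmax_leqP => i _; rewrite -ltnS. Qed.

(* [Phi1 (a+1) >= g^(2a+2)] gives [Phi1 a >= g^(2a+1) = g^(2a) + alpha g^(2a)],
   and the last term pays for the difference between [Phi1 a] and [Phi2 a]. *)
Lemma level_near Phi1 Phi2 :
  (forall a, Phi1 a.+1 <= g * Phi1 a) ->
  (forall a, `|Phi1 a - Phi2 a| <= alpha * g ^+ a) ->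
  (level Phi1 <= (level Phi2).+1)%N.
Proof.
move=> grow near; apply/bigmax_leqP => -[[|a] an] //= Pa.
rewrite ltnS; have an' : (a < n.+1)%N by exact: ltnW.
apply: (@leq_bigmax_cond _ (fun b : 'I_n.+1 => (g ^+ b) ^+ 2 <= Phi2 b)
  (fun b => b : nat) (Ordinal an')) => /=.
have y1 := gX_ge1 a; have := near a; rewrite ler_norml => /andP[_ ].
have := le_trans Pa (grow a); rewrite [g ^+ a.+1]exprS exprMn expr2 -mulrA.
have a0 := alpha_ge0; rewrite ler_pM2l; last by lra.
move: (g ^+ a) (Phi1 a) (Phi2 a) y1 => y p1 p2 y1 h1 h2.
have : alpha * y <= alpha * y ^+ 2 by rewrite ler_wpM2l // expr2; nra.
lra.
Qed.

Lemma level_upper Phi M : 1 <= M -> (forall a, Phi a <= M) ->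
  (g ^+ level Phi) ^+ 2 <= M.
Proof.
move=> M1 PM; apply: (@big_ind _ (fun x => (g ^+ x) ^+ 2 <= M)).
- by rewrite expr0 expr1n.
- by move=> x y; case: (leqP x y).
- by move=> i Pi; exact: le_trans (PM i).
Qed.

Lemma level_lower Phi a : (a <= n)%N -> (g ^+ a) ^+ 2 <= Phi a ->
  (a <= level Phi)%N.
Proof.
rewrite -ltnS => an Pa.
exact: (@leq_bigmax_cond _ (fun b : 'I_n.+1 => (g ^+ b) ^+ 2 <= Phi b)
  (fun b => b : nat) (Ordinal an)).
Qed.

Lemma level_round X : X < n%:R -> n%:R <= (g ^+ n) ^+ 2 ->
  exists a0, [/\ (a0 <= n)%N, a0 = 0%N \/ (g ^+ a0) ^+ 2 <= X &
                 X < (g ^+ a0.+1) ^+ 2].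
Proof.
move=> Xn ng; pose P a := (a == 0%N) || ((g ^+ a) ^+ 2 <= X).
have P0 : exists a, P a by exists 0%N.
have Pn a : P a -> (a <= n)%N.
  move=> /orP[/eqP -> //|Pa]; rewrite leqNgt; apply/negP => na.
  have := lt_le_trans (le_lt_trans Pa Xn) ng; apply/negP; rewrite -leNgt.
  rewrite lerXn2r ?nnegrE ?exprn_ge0 ?addr_ge0 //.
  by apply: ler_weXn2l; [rewrite lerDl|exact: ltnW].
case: (ex_maxnP P0 Pn) => a0 Pa0 maxa0; exists a0; split; first exact: Pn.
  by case/orP: Pa0 => [/eqP|]; [left|right].
rewrite ltNge; apply/negP => h; have /maxa0 : P a0.+1 by rewrite /P h orbT.
by rewrite ltnn.
Qed.

End Level.

(** The union bound at a single outcome, to be summed against the coin law. *)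
Lemma union_bound3 (R : realType) (b1 b2 b3 q : bool) :
  (~~ b1 -> ~~ b2 -> ~~ b3 -> q) ->
  1 - (b1%:R + b2%:R + b3%:R) <= q%:R :> R.
Proof.
move: b1 b2 b3 q => [] [] [] [] H; try by have := H isT isT isT.
all: by rewrite ?mulr1n ?mulr0n; lra.
Qed.

(** * The algorithm: privacy and accuracy *)

Section Algorithm.
Context (R : realType) (n k B K : nat) (tau eta : R).
Hypotheses (n_gt0 : (0 < n)%N) (B_gt0 : (0 < B)%N) (K_gt0 : (0 < K)%N)
  (nkB : (n <= k * B)%N)
  (dvdK : forall d, (0 < d)%N -> (d < n)%N -> (d %| K)%N)
  (tau_ge0 : 0 <= tau) (eta_ge0 : 0 <= eta).
Implicit Types (G : sgraph n) (l : 'I_n -> seq 'I_n).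

(** Chosen so that the scaled sensitivity [B / n * (4 * tau * g ^+ a)] equals [step * g ^+ a], as
    [level_near] requires. *)
Definition step : R := 4 * B%:R * tau / n%:R.
Local Notation g := (1 + step).

Lemma step_ge0 : 0 <= step.
Proof. by rewrite /step divr_ge0 // ?mulr_ge0. Qed.

(** Levels shifted by [n] lie between [n] and [2 * n], so noise of size at most [n] does not wrap
    around. Dividing by [g ^+ n] in [decode] undoes the shift. *)
Definition noise_range := (3 * n)%N.

Definition decode (i : 'I_noise_range.+1) : R := (g ^+ i / g ^+ n) ^+ 2.

Definition statistic (xs : seq R) (a : nat) : R :=
  B%:R / n%:R * \sum_(x <- xs) Num.min x (tau * g ^+ a).

Definition index_of (xs : seq R) : 'I_noise_range.+1 :=
  inord (level n step (statistic xs) + n).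

Definition alg_tree (w : sampling k B K * 'I_noise_range.+1) : qtree R n :=
  probes n [seq sample w.1 j | j <- enum 'I_k]
    (fun xs => decode (index_of xs + w.2)).

Definition coin_pmf (w : sampling k B K * 'I_noise_range.+1) : R :=
  #|sampling k B K|%:R^-1 * noise_pmf eta w.2.

Lemma coin_pmf_ge0 w : 0 <= coin_pmf w.
Proof. by rewrite mulr_ge0 ?invr_ge0 ?noise_pmf_ge0. Qed.

Definition coin0 : sampling k B K * 'I_noise_range.+1 :=
  ([ffun=> (Ordinal B_gt0, Ordinal K_gt0)], ord0).

Lemma sum_coin_pmf (F : sampling k B K -> 'I_noise_range.+1 -> R) :
  \sum_w coin_pmf w * F w.1 w.2 =
  uexp (fun c => \sum_z noise_pmf eta z * F c z).
Proof.
transitivity (\sum_c \sum_z coin_pmf (c, z) * F c z).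
  by rewrite pair_bigA; apply: eq_bigr => -[].
rewrite /uexp mulr_suml; apply: eq_bigr => c _.
by rewrite mulrC mulr_sumr; apply: eq_bigr => z _; rewrite /coin_pmf -mulrA.
Qed.

Lemma uexp1 : uexp (fun c : sampling k B K => 1 : R) = 1.
Proof.
rewrite /uexp sumr_const divff // gt_eqF //.
exact: card_gt0R coin0.1.
Qed.

Lemma coin_pmf_sum1 : \sum_w coin_pmf w = 1.
Proof.
rewrite -[RHS]uexp1; have := sum_coin_pmf (fun _ _ => 1).
under eq_bigr do rewrite mulr1.
move=> ->; rewrite /uexp; congr (_ / _); apply: eq_bigr => c _.
by under eq_bigr do rewrite mulr1; rewrite noise_pmf_sum1.
Qed.

Definition alg : rand_alg R n :=
  finite_alg coin0 coin_pmf_ge0 coin_pmf_sum1 alg_tree.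

Definition lev G l (c : sampling k B K) : nat :=
  level n step (fun a => B%:R / n%:R * est G l (tau * g ^+ a) c).

Lemma result_alg G l w : adj_lists G l ->
  result G l (alg_tree w) = decode (inord (lev G l w.1 + n) + w.2).
Proof.
move=> Gl; rewrite /alg_tree result_probes //; congr decode.
rewrite /index_of /lev; congr (inord (level _ _ _ + _) + _).
apply/funext => a; rewrite /statistic -map_comp big_map big_enum /=.
by [].
Qed.

Lemma alg_runs_within : runs_within alg (3 * k)%:R.
Proof.
move=> L LP G w; rewrite ler_nat.
apply: leq_trans (nqueries_probes _ _ (LP G)) _.
by rewrite size_map size_enum_ord.
Qed.

Lemma est_grow G l (T : R) (c : sampling k B K) :
  0 <= T -> est G l (g * T) c <= g * est G l T c.
Proof.
move=> T0; rewrite /est mulr_sumr; apply: ler_sum => j _.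
have x0 := obs_ge0 R G l (sample c j).1 (sample c j).2.
have s0 := step_ge0; have g0 : 0 <= g by lra.
rewrite minr_pMr //; rewrite le_min !ge_min lexx orbT andbT.
by rewrite ler_peMl // lerDl.
Qed.

Lemma lev_near G1 G2 l1 l2 (c1 c2 : sampling k B K) :
  (forall T : R, 0 <= T -> `|est G1 l1 T c1 - est G2 l2 T c2| <= 4 * T) ->
  (lev G1 l1 c1 <= (lev G2 l2 c2).+1)%N.
Proof.
move=> near; have s0 := step_ge0.
have T0 a : 0 <= tau * g ^+ a by rewrite mulr_ge0 ?exprn_ge0 ?addr_ge0.
have Bn0 : 0 <= B%:R / n%:R :> R by rewrite divr_ge0.
apply: level_near => // [a|a].
  rewrite [leRHS]mulrCA ler_wpM2l // exprS mulrCA.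
  exact: est_grow.
rewrite -mulrBr normrM ger0_norm //.
apply: le_trans (ler_wpM2l Bn0 (near _ (T0 a))) _.
by rewrite /step le_eqVlt; apply/orP; left; apply/eqP; ring.
Qed.

Lemma inordS m x : (x < m)%N -> (inord x.+1 : 'I_m.+1) = inord x + inord 1.
Proof.
case: m => // m xm; apply: val_inj => /=.
by rewrite !inordK ?addn1 ?modn_small // ltnW.
Qed.

Lemma alg_dp : edge_dp eta alg.
Proof.
move=> L LP G1 G2 G12 S _.
rewrite !out_prob_finite_alg -EFinM lee_fin.
pose F G c z : R := (decode (inord (lev G (L G) c + n) + z) \in S)%:R.
have FE G : \sum_w coin_pmf w * (result G (L G) (alg_tree w) \in S)%:R =
    uexp (fun c => \sum_z noise_pmf eta z * F G c z).
  by rewrite -sum_coin_pmf; apply: eq_bigr => w _; rewrite result_alg.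
rewrite !FE /uexp mulrA ler_wpM2r ?invr_ge0 //.
have [b binj bP] := sampling_coupling R nkB dvdK (LP G1) (LP G2) G12.
(* For coupled samplings [b c] and [c] the levels differ by at most 1, so the noise alone pays the
   factor [expR eta]. *)
rewrite (reindex_inj binj) /= mulr_sumr; apply: ler_sum => c _.
apply: (noise_dp eta_ge0 (fun i => decode i \in S)).
have l12 := lev_near (bP c).
have l21 : (lev G2 (L G2) c <= (lev G1 (L G1) (b c)).+1)%N.
  by apply: lev_near => T T0; rewrite distrC bP.
have := level_leq n step
  (fun a => B%:R / n%:R * est G1 (L G1) (tau * g ^+ a) (b c)).
have := level_leq n step
  (fun a => B%:R / n%:R * est G2 (L G2) (tau * g ^+ a) c).
rewrite -!/(lev _ _ _).
move: (lev G1 _ _) (lev G2 _ _) l12 l21 => x y xy yx yn xn.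
have [->|ne] := eqVneq x y; first by left.
right; have [lt|ge] := ltnP x y.
  right; have -> : y = x.+1 by lia.
  by rewrite addSn inordS // /noise_range; lia.
left; have -> : x = y.+1 by move/eqP: ne; lia.
by rewrite addSn inordS // /noise_range; lia.
Qed.

Lemma inord_noise x s (z : 'I_noise_range.+1) :
  (x <= n)%N -> (s <= n)%N -> (cyc_abs z <= s)%N ->
  let i := (inord (x + n) + z)%R : 'I_noise_range.+1 in
  (x + n <= i + s)%N /\ (i <= x + n + s)%N.
Proof.
move=> xn sn zs i.
have iE : i = ((x + n + z) %% noise_range.+1)%N :> nat.
  by rewrite /i /= inordK // /noise_range; lia.
rewrite iE; move: zs; have := ltn_ord z; rewrite /cyc_abs.
move: {i iE} (z : nat) => y; rewrite /noise_range => ylt ys.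
have [yy|yy] := leqP y s; first by rewrite modn_small; lia.
(* A large [y] encodes the negative shift [y - (3 * n).+1], of size at most [s]. *)
have -> : (x + n + y = 1 * (3 * n).+1 + (x + n + y - (3 * n).+1))%N by lia.
by rewrite modnMDl modn_small; lia.
Qed.

Lemma decode_accurate (rho d : R) x s (z : 'I_noise_range.+1) :
  0 < rho <= 2^-1 -> 0 <= d ->
  (x <= n)%N -> (s <= n)%N -> (cyc_abs z <= s)%N ->
  (g ^+ s.+1) ^+ 2 <= 1 + rho / 4 ->
  (g ^+ x) ^+ 2 <= (1 + rho / 4) * d ->
  (1 - rho / 4) * d <= (g ^+ x.+1) ^+ 2 ->
  (1 - rho) * d <= decode (inord (x + n) + z) <= (1 + rho) * d.
Proof.
move=> /andP[r0 r1] d0 xn sn zs gs up low.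
have [i1 i2] := inord_noise xn sn zs; rewrite /decode.
move: (inord (x + n) + z) i1 i2 => i i1 i2.
have g1 : 1 <= g by rewrite lerDl step_ge0.
have gp a : 0 < g ^+ a by rewrite exprn_gt0 // (lt_le_trans ltr01).
have h1 : g ^+ i / g ^+ n <= g ^+ x * g ^+ s.
  by rewrite ler_pdivrMr // -!exprD ler_weXn2l //; lia.
(* The bound [low] sits one grid step above [x], hence [s.+1] rather than [s]. *)
have h2 : g ^+ x.+1 <= g ^+ i / g ^+ n * g ^+ s.+1.
  by rewrite mulrAC ler_pdivlMr // -!exprD ler_weXn2l //; lia.
have y0 : 0 <= g ^+ i / g ^+ n by rewrite divr_ge0 // ltW.
have gss : (g ^+ s) ^+ 2 <= 1 + rho / 4.
  apply: le_trans gs; rewrite lerXn2r ?nnegrE ?(ltW (gp _)) //.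
  by apply: ler_weXn2l.
move: (g ^+ i / g ^+ n) y0 h1 h2 => y y0 h1 h2.
have {}h1 : y ^+ 2 <= (g ^+ x) ^+ 2 * (g ^+ s) ^+ 2.
  by rewrite -exprMn lerXn2r // nnegrE // mulr_ge0 // ltW.
have {}h2 : (g ^+ x.+1) ^+ 2 <= y ^+ 2 * (g ^+ s.+1) ^+ 2.
  by rewrite -exprMn lerXn2r ?nnegrE ?mulr_ge0 // ltW.
apply/andP; split.
  have : (1 - rho / 4) * d <= y ^+ 2 * (1 + rho / 4).
    apply: le_trans (le_trans low h2) _.
    by rewrite ler_wpM2l // sqr_ge0.
  have : (1 - rho) * d * (1 + rho / 4) <= (1 - rho / 4) * d.
    rewrite -subr_ge0.
    have -> : (1 - rho / 4) * d - (1 - rho) * d * (1 + rho / 4)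
      = d * (rho / 2 + rho ^+ 2 / 4) by field.
    by rewrite mulr_ge0 // addr_ge0 ?divr_ge0 ?sqr_ge0 // ltW.
  move=> a1 a2; have := le_trans a1 a2; rewrite ler_pM2r //; lra.
apply: le_trans h1 _.
apply: (@le_trans _ _ ((1 + rho / 4) * d * (1 + rho / 4))).
  by rewrite ler_pM ?sqr_ge0.
rewrite -subr_ge0; have -> : (1 + rho) * d - (1 + rho / 4) * d * (1 + rho / 4)
   = d * (rho * (2^-1 - rho / 16)) by field.
by rewrite !mulr_ge0 // ?ltW //; lra.
Qed.

(** From above, the untruncated sum dominates all truncated ones at once. From below, a maximum
    needs only one witness, [a0]. So two concentration events suffice for all levels. *)
Lemma lev_accurate G l (rho : R) (a0 : nat)
    (c : sampling k B K) :
  let D := deg_sum R G in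
  let lam := rho / 8 * (D / B%:R) in
  let T := tau * g ^+ a0 in
  0 < rho <= 2^-1 -> n%:R <= D -> (a0 <= n)%N ->
  0 < tau -> 2 * Num.sqrt D <= rho * T -> adj_lists G l ->
  a0 = 0%N \/ (g ^+ a0) ^+ 2 <= (1 - rho / 4) * (D / n%:R) ->
  (1 - rho / 4) * (D / n%:R) < (g ^+ a0.+1) ^+ 2 ->
  `|usum G l id c - \sum_(j < k) probe_mean B K G l id j| < lam ->
  `|usum G l (fun x => Num.min x T) c
      - \sum_(j < k) probe_mean B K G l (fun x => Num.min x T) j| < lam ->
  (g ^+ lev G l c) ^+ 2 <= (1 + rho / 4) * (D / n%:R) /\
  (1 - rho / 4) * (D / n%:R) <= (g ^+ (lev G l c).+1) ^+ 2.
Proof.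
move=> D lam T /andP[r0 r1] nD a0n t0 TD Gl a0P X1.
have n0 : 0 < n%:R :> R by rewrite ltr0n.
have B0 : 0 < B%:R :> R by rewrite ltr0n.
have g1 : 1 <= g by rewrite lerDl step_ge0.
have T0 : 0 < T by rewrite mulr_gt0 // exprn_gt0 // (lt_le_trans ltr01).
have D0 : 0 < D by exact: lt_le_trans nD.
have dbar1 : 1 <= D / n%:R by rewrite ler_pdivlMr // mul1r.
have Bn0 : 0 < B%:R / n%:R :> R by rewrite divr_gt0.
have scale x : B%:R / n%:R * (x * (D / B%:R)) = x * (D / n%:R).
  by field; rewrite !gt_eqF.
rewrite (probe_mean_id R nkB B_gt0 K_gt0 dvdK Gl) -/D.
have := probe_mean_cap nkB B_gt0 K_gt0 dvdK Gl T0; rewrite -/D.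
set mu := \sum_j _; rewrite !ltr_norml => mulow /andP[_ u2] /andP[v1 _].
split.
  apply: level_upper.
    by rewrite -[leLHS]mulr1 ler_pM //; lra.
  move=> a; apply: (@le_trans _ _ (B%:R / n%:R * usum G l id c)).
    rewrite ler_pM2l // /est /usum; apply: ler_sum => j _.
    by rewrite ge_min lexx.
  apply: (@le_trans _ _ (B%:R / n%:R * ((1 + rho / 8) * (D / B%:R)))).
    by rewrite ler_pM2l //; move: u2; rewrite /lam; lra.
  by rewrite scale ler_pM2r ?(lt_le_trans ltr01) //; lra.
(* Truncation bias and deviation cost [lam] each, together the fraction [rho / 4] of the mean. *)
have bias : D * Num.sqrt D / B%:R / (4 * T) <= lam.
  rewrite ler_pdivrMr; last by lra.
  have -> : lam * (4 * T) = (rho * T / 2) * (D / B%:R).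
    by rewrite /lam; field; rewrite gt_eqF.
  have -> : D * Num.sqrt D / B%:R = Num.sqrt D * (D / B%:R).
    by rewrite mulrAC mulrC.
  rewrite ler_pM2r ?divr_gt0 //; lra.
have a0lev : (a0 <= lev G l c)%N.
  case: a0P => [->//|a0P]; apply: level_lower => //.
  apply: le_trans a0P _; rewrite -scale ler_pM2l //.
  have : mu - lam <= usum G l (fun x => Num.min x T) c by lra.
  by apply: le_trans; move: mulow bias; rewrite /lam; lra.
apply: le_trans (ltW X1) _.
rewrite lerXn2r ?nnegrE ?exprn_ge0 ?(le_trans ler01) //.
by apply: ler_weXn2l.
Qed.

Lemma alg_accurate L G (rho : R) s (S : set R) :
  numbering L -> 0 < rho <= 2^-1 -> n%:R <= deg_sum R G ->
  0 < tau -> 32 * n%:R <= rho ^+ 2 * tau ^+ 2 -> step <= 1 ->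
  n%:R <= (g ^+ n) ^+ 2 -> (s <= n)%N ->
  (g ^+ s.+1) ^+ 2 <= 1 + rho / 4 ->
  (forall d, (1 - rho) * avg_degree R G <= d <= (1 + rho) * avg_degree R G ->
     S d) ->
  ((1 - (128 * B%:R / (rho ^+ 2 * Num.sqrt n%:R)
     + noise_range.+1%:R * expR (- (eta * s%:R))))%:E <=
   out_prob alg L G S)%E.
Proof.
move=> LP rr nD t0 tauP step1 ng sn gs Ssub.
have /andP[r0 r1] := rr; have Gl := LP G; set l := L G in Gl *.
set D := deg_sum R G in nD *.
have n0 : 0 < n%:R :> R by rewrite ltr0n.
have B0 : 0 < B%:R :> R by rewrite ltr0n.
have D0 : 0 < D by exact: lt_le_trans nD.
have g1 : 1 <= g by rewrite lerDl step_ge0.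
have dn : D / n%:R < n%:R.
  rewrite ltr_pdivrMr //.
  apply: (@lt_le_trans _ _ (\sum_(v < n) n%:R)); last first.
    by rewrite sumr_const card_ord mulr_natr.
  rewrite /D /deg_sum; apply: ltr_sum; last first.
    by move=> v _; rewrite ltr_nat deg_lt.
  by apply/hasP; exists (Ordinal n_gt0); rewrite // mem_index_enum.
have Xn : (1 - rho / 4) * (D / n%:R) < n%:R.
  have : 0 < D / n%:R by rewrite divr_gt0.
  by move: dn; move: (D / n%:R) => d; nra.
have [a0 [a0n a0P X1]] := level_round step_ge0 Xn ng.
pose T := tau * g ^+ a0; pose lam := rho / 8 * (D / B%:R).
have lam0 : 0 < lam by rewrite !mulr_gt0 ?invr_gt0.
have TD : 2 * Num.sqrt D <= rho * T.
  have rT : 0 <= rho * T.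
    by rewrite !mulr_ge0 ?ltW // exprn_gt0 // (lt_le_trans ltr01).
  rewrite -(@ler_pXn2r _ 2) ?nnegrE // ?mulr_ge0 ?sqrtr_ge0 //.
  rewrite /T !exprMn sqr_sqrtr ?(ltW D0) //.
  have y0 : 0 <= (g ^+ a0) ^+ 2 by exact: sqr_ge0.
  have g4 : g ^+ 2 <= 4.
    by have := step_ge0; move: step1; move: step => x x1 x0; nra.
  (* By maximality of [a0] and [g ^+ 2 <= 4]. Then [4 * D <= 32 * n * (g ^+ a0) ^+ 2], which
     explains the constant 32 in [tauP]. *)
  have yD : D / n%:R <= 8 * (g ^+ a0) ^+ 2.
    have := ler_wpM2r y0 g4; move: X1; rewrite [g ^+ a0.+1]exprS exprMn.
    have : 0 < D / n%:R by rewrite divr_gt0.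
    move: (D / n%:R) ((g ^+ a0) ^+ 2) (g ^+ 2) => d y h d0 xd hy.
    have : 0 <= d * (2^-1 - rho) by rewrite mulr_ge0; lra.
    lra.
  rewrite ler_pdivrMr // in yD.
  have := ler_wpM2r y0 tauP; move: yD.
  move: ((g ^+ a0) ^+ 2) => y yD h.
  apply: le_trans (_ : _ <= rho ^+ 2 * tau ^+ 2 * y) _; last by rewrite mulrA.
  apply: le_trans h.
  by rewrite -natrX; lra.
pose b1 (c : sampling k B K) : R :=
  (lam <= `|usum G l id c - \sum_(j < k) probe_mean B K G l id j|)%R%:R.
pose b2 (c : sampling k B K) : R :=
  (lam <= `|usum G l (fun x => Num.min x T) c
    - \sum_(j < k) probe_mean B K G l (fun x => Num.min x T) j|)%R%:R.
pose b3 (z : 'I_noise_range.+1) : R := (s < cyc_abs z)%N%:R.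
have ub (phi : R -> R) : (forall x, 0 <= x -> 0 <= phi x <= x) ->
    uexp (fun c : sampling k B K => (lam <= `|usum G l phi c
      - \sum_(j < k) probe_mean B K G l phi j|)%R%:R)
    <= 64 * B%:R / (rho ^+ 2 * Num.sqrt n%:R).
  move=> phiP.
  have H := usum_concentration nkB B_gt0 K_gt0 dvdK Gl lam0 phiP.
  apply: (le_trans H).
  have sD0 : 0 < Num.sqrt D by rewrite sqrtr_gt0.
  have sn0 : 0 < Num.sqrt n%:R :> R by rewrite sqrtr_gt0.
  (* This is the Chebyshev bound rewritten with the value of [lam]; [n <= D] then replaces [D] by
     [n]. Two such events give 128. *)
  apply: (@le_trans _ _ (64 * B%:R / (rho ^+ 2 * Num.sqrt D))).
    have Dq : D = Num.sqrt D ^+ 2 by rewrite sqr_sqrtr // ltW.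
    rewrite -/D /lam; move: (Num.sqrt D) sD0 Dq => q q0 ->.
    rewrite le_eqVlt; apply/orP; left; apply/eqP.
    by field; rewrite !gt_eqF.
  rewrite ler_pM2l; last by rewrite mulr_gt0.
  rewrite lef_pV2 ?posrE ?mulr_gt0 ?exprn_gt0 //.
  by rewrite ler_pM2l ?exprn_gt0 // ler_wsqrtr.
have ub1 : uexp b1 <= 64 * B%:R / (rho ^+ 2 * Num.sqrt n%:R).
  by apply: (ub id) => x x0; rewrite x0 lexx.
have T0 : 0 <= T by rewrite mulr_ge0 // exprn_ge0 // (le_trans ler01).
have ub2 : uexp b2 <= 64 * B%:R / (rho ^+ 2 * Num.sqrt n%:R).
  by apply: (ub (fun x => Num.min x T)) => x x0;
    rewrite le_min x0 T0 ge_min lexx.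
have ub3 := noise_tail noise_range eta_ge0 s.
rewrite out_prob_finite_alg lee_fin.
apply: (@le_trans _ _ (\sum_w coin_pmf w * (1 - (b1 w.1 + b2 w.1 + b3 w.2)))).
  rewrite (sum_coin_pmf (fun c z => 1 - (b1 c + b2 c + b3 z))).
  have -> : uexp (fun c => \sum_z noise_pmf eta z * (1 - (b1 c + b2 c + b3 z)))
     = 1 - (uexp b1 + uexp b2
         + \sum_(z | (s < cyc_abs z)%N) noise_pmf eta (z : 'I_noise_range.+1)).
    set q := \sum_(z | _) _.
    transitivity (uexp (fun c : sampling k B K => 1 - (b1 c + b2 c + q))).
      rewrite /uexp; congr (_ / _); apply: eq_bigr => c _.
      rewrite (eq_bigr (fun z => noise_pmf eta z * (1 - (b1 c + b2 c))
        - (if (s < cyc_abs z)%N then noise_pmf eta z else 0))); last first.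
        move=> z _; rewrite /b3.
        by case: ltnP => _; rewrite ?mulr1n ?mulr0n; ring.
      by rewrite sumrB -mulr_suml noise_pmf_sum1 -big_mkcond /= -/q; ring.
    rewrite -[in RHS]uexp1 /uexp -!mulrDl.
    have C0 : #|sampling k B K|%:R != 0 :> R.
      by rewrite gt_eqF // (card_gt0R _ coin0.1).
    rewrite sumrB !big_split /= !sumr_const -[q *+ _]mulr_natr.
    by field.
  by lra.
apply: ler_sum => w _; rewrite ler_wpM2l ?coin_pmf_ge0 //.
rewrite result_alg // -/l.
have := @lev_accurate G l rho a0 w.1 rr nD a0n t0 TD Gl a0P X1.
rewrite -/D -/lam -/T /b1 /b2 /b3 !ltNge => acc.
apply: union_bound3 => h1 h2 h3; have [up low] := acc h1 h2.
rewrite inE; apply: Ssub; apply: (decode_accurate rr _ _ sn) => //.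
- by rewrite divr_ge0 // ltW.
- exact: level_leq.
- by rewrite leqNgt.
Qed.

End Algorithm.

(** * Bernoulli inequalities and the choice of parameters *)

Lemma bernoulli_ge (R : realType) (x : R) n : 0 <= x ->
  1 + n%:R * x <= (1 + x) ^+ n.
Proof.
move=> x0; elim: n => [|n IH]; first by rewrite mul0r addr0 expr0.
have n0 := ler0n R n; rewrite exprS -[n.+1]addn1 natrD.
have : (1 + x) * (1 + n%:R * x) <= (1 + x) * (1 + x) ^+ n.
  by rewrite ler_wpM2l // addr_ge0.
have : 0 <= n%:R * x * x by rewrite !mulr_ge0.
lra.
Qed.

Lemma bernoulli_le (R : realType) (x : R) n : 0 <= x -> n%:R * x < 1 ->
  (1 + x) ^+ n <= (1 - n%:R * x)^-1.
Proof.
move=> x0 nx; rewrite -[leRHS]mul1r ler_pdivlMr; last by lra.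
elim: n nx => [|n IH]; first by rewrite mul0r subr0 expr0 mulr1.
have n0 := ler0n R n; rewrite -[n.+1]addn1 natrD mulrDl mul1r => nx.
apply: le_trans (IH _); last by lra.
rewrite addn1 exprSr -mulrA ler_wpM2l ?exprn_ge0 ?addr_ge0 //.
have : 0 <= n%:R * x * x by rewrite !mulr_ge0.
have := sqr_ge0 x; rewrite expr2; lra.
Qed.

Section ParameterChoice.
Context (R : realType) (n : nat) (rho eps : R).
Local Notation ell := (ln n%:R : R).
Hypotheses (rho_gt0 : 0 < rho) (rho_le : rho <= 2^-1)
  (ell_large : 400 <= rho * ell) (eps_large : ell^-1 <= eps).

Let ell_ge : 800 <= ell.
Proof.
have [l0|l0] := leP 0 ell; last first.
  by have := ell_large; have := rho_gt0; nra.
by have := ell_large; have := ler_wpM2r l0 rho_le; lra.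
Qed.

Let n_gt0 : (0 < n)%N.
Proof.
by case: n ell_ge => // ; rewrite mulr0n ln0 //; lra.
Qed.

Let nE : n%:R = expR ell.
Proof. by rewrite lnK // posrE ltr0n. Qed.

Let r := Num.sqrt n%:R : R.

Let r_gt0 : 0 < r. Proof. by rewrite sqrtr_gt0 ltr0n. Qed.

Let r2 : n%:R = r ^+ 2. Proof. by rewrite sqr_sqrtr. Qed.

Let ell4_le : ell ^+ 4 <= r.
Proof.
have l0 := ell_ge.
rewrite -[leLHS]ger0_norm; last by rewrite exprn_ge0 //; lra.
rewrite -sqrtr_sqr ler_wsqrtr // -exprM [leRHS]nE.
(* Since [expR x >= x], this is at least [(ell / 16) ^+ 16], and [(ell / 16) ^+ 2 >= ell] for
   [ell >= 256]. *)
have -> : expR ell = expR (ell / 16) ^+ (2 * 8).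
  by rewrite -expRM_natl; congr expR; field.
apply: (@le_trans _ _ ((ell / 16) ^+ (2 * 8))); last first.
  have l16 : 0 <= ell / 16 by rewrite divr_ge0 //; lra.
  rewrite lerXn2r ?nnegrE ?expR_ge0 //.
  by apply: le_trans (expR_ge1Dx _); lra.
have l1 : 0 <= ell by lra.
rewrite [leRHS]exprM lerXn2r ?nnegrE ?sqr_ge0 //.
by rewrite expr2; nra.
Qed.

(** Small enough for a grid step of at most [4 / ell ^+ 3], large enough to leave only order
    [r * ell ^+ 4] blocks. *)
Let B := Num.truncn (r / ell ^+ 4).

Let x_ge1 : 1 <= r / ell ^+ 4.
Proof.
rewrite ler_pdivlMr ?mul1r // exprn_gt0 //; have := ell_ge; lra.
Qed.

Let B_gt0 : (0 < B)%N. Proof. by rewrite truncn_gt0. Qed.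

Let B_le : B%:R * ell ^+ 4 <= r.
Proof.
rewrite -ler_pdivlMr; last by rewrite exprn_gt0 //; have := ell_ge; lra.
by rewrite truncn_le (le_trans ler01).
Qed.

Let B_ge : r <= 2 * (B%:R * ell ^+ 4).
Proof.
have l4 : 0 < ell ^+ 4 by rewrite exprn_gt0 //; have := ell_ge; lra.
rewrite mulrA -ler_pdivrMr //.
have := truncnS_gt (r / ell ^+ 4); rewrite -/B -natr1.
have : 1 <= B%:R :> R by rewrite ler1n.
lra.
Qed.

Let k := (n %/ B).+1.
(** Then [tau ^+ 2 = ell ^+ 2 * n], and [400 <= rho * ell] leaves room for the factor 32. *)
Let tau := ell * r.
(** With [1 / ell <= eps] this gives [eps * s >= 2 * ell], so the noise exceeds [s] with probability
    at most [(3 * n + 1) / n ^+ 2]. *)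
Let s := (Num.truncn (2 * ell ^+ 2)).+1.

Let nkB : (n <= k * B)%N. Proof. exact/ltnW/ltn_ceil. Qed.

(* Makes the neighbour index [r %% d] of a uniform [r < n`!] exactly uniform. *)
Let dvdK d : (0 < d)%N -> (d < n)%N -> (d %| n`!)%N.
Proof. by move=> d0 dn; rewrite dvdn_fact // d0 ltnW. Qed.

Let tau_gt0 : 0 < tau.
Proof. by rewrite mulr_gt0 //; have := ell_ge; lra. Qed.

Let eps_ge0 : 0 <= eps.
Proof.
by apply: le_trans eps_large; rewrite invr_ge0; have := ell_ge; lra.
Qed.

Let st := @step R n B tau.

Let ell_pos : 0 < ell. Proof. by have := ell_ge; lra. Qed.

Let stE : st = 4 * B%:R * ell / r.
Proof.
rewrite /st /step /tau r2; field.
by rewrite gt_eqF.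
Qed.

Let st_ge0 : 0 <= st. Proof. exact: step_ge0 (ltW tau_gt0). Qed.

Let st_le : st * ell ^+ 3 <= 4.
Proof.
rewrite stE mulrAC ler_pdivrMr //.
have -> : 4 * B%:R * ell * ell ^+ 3 = 4 * (B%:R * ell ^+ 4) by ring.
by rewrite ler_pM2l.
Qed.

Let st_le1 : st <= 1.
Proof.
have l3 : 4 <= ell ^+ 3.
  have l1 := ell_ge; rewrite exprS; have := exprn_ege1 2 (_ : 1 <= ell); nra.
have := st_le; have := st_ge0; nra.
Qed.

Let n_le_pow : n%:R <= ((1 + st) ^+ n) ^+ 2.
Proof.
rewrite {1}r2 lerXn2r ?nnegrE ?exprn_ge0 ?addr_ge0 ?(ltW r_gt0) //.
apply: le_trans (bernoulli_ge n st_ge0).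
rewrite stE.
have -> : n%:R * (4 * B%:R * ell / r) = 4 * (B%:R * ell) * r.
  by rewrite [X in X * _]r2; field; rewrite gt_eqF.
have : 1 <= B%:R * ell.
  by rewrite mulr_ege1 ?ler1n //; have := ell_ge; lra.
have := r_gt0; nra.
Qed.

Let s_ge : 2 * ell ^+ 2 <= s%:R.
Proof. exact/ltW/truncnS_gt. Qed.

Let s_le : s%:R <= 2 * ell ^+ 2 + 1.
Proof. by rewrite /s -natr1 lerD2r truncn_le mulr_ge0 ?sqr_ge0. Qed.

Let s_len : (s <= n)%N.
Proof.
rewrite -(ler_nat R); apply: le_trans s_le _.
have l1 := ell_ge; have l4 := ell4_le; have r1 : 1 <= r.
  by apply: le_trans l4; apply: exprn_ege1; lra.
apply: (@le_trans _ _ r); last by rewrite r2 expr2 ler_peMl // ltW.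
apply: le_trans l4; have -> : ell ^+ 4 = ell ^+ 2 * ell ^+ 2 by ring.
have : 3 <= ell ^+ 2 by rewrite expr2; nra.
nra.
Qed.

Let pow_s_le : ((1 + st) ^+ s.+1) ^+ 2 <= 1 + rho / 4.
Proof.
have l1 := ell_ge; have r0 := rho_gt0.
(* At most [5 * ell ^+ 2] steps of size at most [4 / ell ^+ 3] add up to [20 / ell], and
   [400 <= rho * ell]. *)
have small : (s.+1 * 2)%:R * st <= rho / 16.
  have h1 : (s.+1 * 2)%:R <= 5 * ell ^+ 2.
    rewrite natrM -natr1; have := s_le.
    have : 4 <= ell ^+ 2 by rewrite expr2; nra.
    lra.
  apply: (le_trans (ler_wpM2r st_ge0 h1)).
  rewrite -(ler_pM2r ell_pos).
  have -> : 5 * ell ^+ 2 * st * ell = 5 * (st * ell ^+ 3) by ring.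
  by have := st_le; have := ell_large; lra.
rewrite -exprM; apply: le_trans (bernoulli_le st_ge0 _) _.
  by have := rho_le; lra.
rewrite -[leLHS]mul1r ler_pdivrMr; last by have := rho_le; lra.
have := rho_le; move: (_ * st) small => y small r1.
have : rho * y <= rho * (rho / 16) by rewrite ler_pM2l.
have : rho * rho <= rho * 2^-1 by rewrite ler_pM2l.
by lra.
Qed.

Let failure_le : 128 * B%:R / (rho ^+ 2 * r)
  + (noise_range n).+1%:R * expR (- (eps * s%:R)) <= 5 / ell.
Proof.
have l1 := ell_ge; have r0 := rho_gt0; have l0 := ell_pos.
have f1 : 128 * B%:R / (rho ^+ 2 * r) <= 1 / ell.
  rewrite ler_pdivrMr ?mulr_gt0 ?exprn_gt0 // mulrAC ler_pdivlMr // mul1r.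
  have h : 128 <= rho ^+ 2 * ell ^+ 3.
    have -> : rho ^+ 2 * ell ^+ 3 = (rho * ell) ^+ 2 * ell by ring.
    have : 1 <= (rho * ell) ^+ 2 by apply: exprn_ege1; have := ell_large; lra.
    nra.
  apply: (@le_trans _ _ (rho ^+ 2 * (B%:R * ell ^+ 4))); last first.
    by rewrite ler_pM2l // exprn_gt0.
  have -> : rho ^+ 2 * (B%:R * ell ^+ 4) = rho ^+ 2 * ell ^+ 3 * (B%:R * ell)
    by ring.
  by rewrite -[128 * _ * _]mulrA ler_wpM2r // mulr_ge0 // ltW.
have f2 : (noise_range n).+1%:R * expR (- (eps * s%:R)) <= 4 / ell.
  have es : 2%:R * ell <= eps * s%:R.
    apply: (@le_trans _ _ (ell^-1 * (2 * ell ^+ 2))).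
      by rewrite le_eqVlt; apply/orP; left; apply/eqP; field; rewrite gt_eqF.
    by rewrite ler_pM // ?invr_ge0 ?mulr_ge0 ?sqr_ge0 // ltW.
  apply: (@le_trans _ _ ((noise_range n).+1%:R * expR (- (2%:R * ell)))).
    by rewrite ler_wpM2l // ler_expR lerN2.
  rewrite expRN expRM_natl -nE ler_pdivrMr ?exprn_gt0 ?ltr0n //.
  have n1 : 1 <= n%:R :> R by rewrite ler1n.
  have nl : ell <= n%:R.
    by rewrite [leRHS]nE; apply: le_trans (expR_ge1Dx _); lra.
  rewrite -natr1 /noise_range natrM mulrAC ler_pdivlMr // expr2.
  have : n%:R * ell <= n%:R * n%:R by rewrite ler_wpM2l.
  by nra.
have -> : 5 / ell = 1 / ell + 4 / ell by ring.
exact: lerD.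
Qed.

Lemma exists_private_alg : exists A : rand_alg R n,
  [/\ edge_dp eps A, runs_within A (9 * r * ell ^+ 4) &
      forall L, numbering L -> forall G, 1 <= avg_degree R G ->
      forall S : set R, (forall d,
        (1 - rho) * avg_degree R G <= d <= (1 + rho) * avg_degree R G -> S d) ->
      ((1 - 5 / ell)%:E <= out_prob A L G S)%E].
Proof.
have l1 := ell_ge; have n0 : 0 < n%:R :> R by rewrite ltr0n.
have B0 : 0 < B%:R :> R by rewrite ltr0n.
exists (@alg R n k B n`! tau eps B_gt0 (fact_gt0 n)); split.
- exact: (alg_dp n_gt0 B_gt0 (fact_gt0 n) nkB dvdK (ltW tau_gt0) eps_ge0).
- move=> L LP G w; apply: le_trans (alg_runs_within LP G w) _.
  have h1 : (n %/ B)%:R <= 2 * (r * ell ^+ 4).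
    apply: (@le_trans _ _ (n%:R / B%:R)).
      by rewrite ler_pdivlMr // -natrM ler_nat leq_divM.
    rewrite ler_pdivrMr // {1}r2 expr2.
    have -> : 2 * (r * ell ^+ 4) * B%:R = r * (2 * (B%:R * ell ^+ 4)) by ring.
    by rewrite ler_pM2l.
  have h2 : 1 <= r * ell ^+ 4.
    have h4 : 1 <= ell ^+ 4 by apply: exprn_ege1; lra.
    by rewrite mulr_ege1 // (le_trans h4).
  rewrite /k natrM -natr1 -mulrA; lra.
- move=> L LP G G1 S SP.
  have nD : n%:R <= deg_sum R G.
    by move: G1; rewrite /avg_degree ler_pdivlMr // mul1r.
  have rr : 0 < rho <= 2^-1 by rewrite rho_gt0.
  have tP : 32 * n%:R <= rho ^+ 2 * tau ^+ 2.
    rewrite /tau exprMn -r2 mulrA ler_wpM2r // -exprMn expr2.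
    by have := ell_large; nra.
  have := alg_accurate n_gt0 B_gt0 (fact_gt0 n) nkB dvdK
    (ltW tau_gt0) eps_ge0 LP rr nD tau_gt0 tP st_le1 n_le_pow s_len pow_s_le SP.
  by apply: le_trans; rewrite lee_fin lerB // failure_le.
Qed.

End ParameterChoice.

(** * Assembling the family of algorithms *)

Lemma sum_unit1 (R : realType) : \sum_(w : unit) 1 = 1 :> R.
Proof. by rewrite big_const card_unit /= addr0. Qed.

Definition const_alg (R : realType) (n : nat) (x : R) : rand_alg R n :=
  @finite_alg R unit tt (fun=> 1) (fun=> ler01) (sum_unit1 R) n
    (fun=> Output n x).

Theorem theorem1 (R : realType) :
  exists (p q : {poly R}) (C : R) (N : nat),
  forall (rho : R) (eps : nat -> R),
    0 < rho ->
    (forall n, 0 < eps n) ->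
    (fun n => ((eps n)^-1)%R : R^o) =o_\oo
      (fun n => (ln n%:R `^ 4^-1)%R : R^o) ->
  exists A : forall n, rand_alg R n,
    [/\ forall n, edge_dp (eps n) (A n),
        approximates_avg_degree rho A &
        forall n, (N <= n)%N ->
          runs_within (A n)
            (C * (Num.sqrt n%:R * p.[ln n%:R / rho] * q.[(eps n)^-1]))].
Proof.
(* For good [n], [9 * ell ^+ 4 <= ell ^+ 5] with [ell = ln n], and [rho ^+ 2 <= ell] gives
   [ell <= (ell / rho) ^+ 2]; hence the exponent 10. The dependence on [1 / eps] is absorbed because
   it is at most [ell]. *)
exists 'X^10, 1, 1, 1%N => rho eps rho0 eps0 epso.
(* The accuracy analysis needs an error of at most 1/2; a smaller error is also valid for [rho]. *)
pose rho' := Num.min rho 2^-1.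
have r'0 : 0 < rho' by rewrite lt_min rho0 /= invr_gt0 ltr0n.
have r'le : rho' <= 2^-1 by rewrite ge_min lexx orbT.
have r'rho : rho' <= rho by rewrite ge_min lexx.
pose good n := [/\ 400 <= rho' * ln n%:R, (ln n%:R)^-1 <= eps n
  & rho ^+ 2 <= ln n%:R :> R].
have algP n : exists A : rand_alg R n,
  [/\ edge_dp (eps n) A,
      (1 <= n)%N ->
        runs_within A (1 * (Num.sqrt n%:R * ('X^10).[ln n%:R / rho]
          * (1 : {poly R}).[(eps n)^-1])) &
      good n -> forall L, numbering L -> forall G, 1 <= avg_degree R G ->
      ((1 - 5 / ln n%:R)%:E <= out_prob A L G
        [set d : R | ((1 - rho) * avg_degree R G <= d <=
                    (1 + rho) * avg_degree R G)%R])%E].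
  rewrite mul1r hornerXn hornerC mulr1.
  have [[g1 g2 g3]|bad] := pselect (good n).
    have [A [Adp Arun Aacc]] := exists_private_alg r'0 r'le g1 g2.
    exists A; split=> // [_ L LP G w|_ L LP G G1].
      apply: le_trans (Arun L LP G w) _.
      rewrite [9 * _]mulrC -mulrA ler_wpM2l ?sqrtr_ge0 //.
      have l0 : 0 <= ln n%:R :> R by exact: le_trans (sqr_ge0 rho) g3.
      have l9 : 9 <= ln n%:R :> R.
        by have := ler_wpM2r l0 r'le; lra.
      rewrite (exprM _ 2 5).
      have le2 : ln n%:R <= (ln n%:R / rho) ^+ 2.
        rewrite expr_div_n ler_pdivlMr ?exprn_gt0 // [leRHS]expr2.
        by rewrite ler_wpM2l.
      apply: (@le_trans _ _ (ln n%:R ^+ 5)); last first.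
        by rewrite lerXn2r ?nnegrE ?sqr_ge0.
      by rewrite [leRHS]exprS ler_wpM2r // exprn_ge0.
    apply: Aacc => // d /andP[d1 d2] /=.
    have r'a : rho' * avg_degree R G <= rho * avg_degree R G.
      by rewrite ler_wpM2r // (le_trans ler01).
    by apply/andP; split; lra.
  (* Outside [good], a constant output is private and makes no query; the even exponent makes the
     time bound nonnegative. *)
  exists (const_alg n 0); split=> // [L LP G1 G2 _ S _|_ L LP G w].
    rewrite !out_prob_finite_alg /= -EFinM lee_fin.
    rewrite ler_peMl //; first by apply: sumr_ge0 => w _; rewrite mulr_ge0.
    by rewrite -[leLHS]addr0 (le_trans _ (expR_ge1Dx _)) // lerD2l ltW.
  by rewrite mulr_ge0 ?sqrtr_ge0 // exprn_even_ge0.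
pose A n := sval (cid (algP n)).
have AP n := svalP (cid (algP n)); rewrite -/(A _) in AP.
exists A; split.
- by move=> n; have [] := AP n.
- move=> delta d0.
  have ln_ge (M : R) : \forall n \near \oo, M <= ln (n%:R : R).
    near=> n.
    have eMn : expR M <= n%:R by near: n; exact: nbhs_infty_ger.
    rewrite -[M]expRK ler_ln ?posrE ?expR_gt0 //.
    exact: lt_le_trans (expR_gt0 M) eMn.
  near=> n => L LP G G1.
  have lM : 400 / rho' <= ln n%:R :> R by near: n; exact: ln_ge.
  have lr : rho ^+ 2 <= ln n%:R :> R by near: n; exact: ln_ge.
  have ld : 5 / delta <= ln n%:R :> R by near: n; exact: ln_ge.
  have l1 : 1 <= ln n%:R :> R by near: n; exact: ln_ge.
  have l0 : 0 < ln n%:R :> R by exact: lt_le_trans l1.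
  (* The little-o hypothesis with constant 1; since [1 <= ln n], it yields [1 / eps n <= ln n]. *)
  have en : (eps n)^-1 <= ln n%:R `^ 4^-1.
    near: n; have /eqoP/(_ 1 ltr01) := epso; apply: filterS => n.
    rewrite mul1r ger0_norm ?invr_ge0 ?(ltW (eps0 n)) //.
    by rewrite ger0_norm // powR_ge0.
  have gn : good n.
    split=> //; first by rewrite mulrC -ler_pdivrMr.
    rewrite -[eps n]invrK lef_pV2 ?posrE ?invr_gt0 ?eps0 //.
    apply: le_trans en _; rewrite -[leRHS]powRr1 ?(ltW l0) //.
    by apply: ler_powR => //; rewrite invf_le1 // ler1n.
  have [_ _ /(_ gn L LP G G1)] := AP n; apply: le_trans.
  rewrite lee_fin lerB // ler_pdivrMr // mulrC -ler_pdivrMr //.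
- by move=> n n1; have [_ + _] := AP n; apply.
Unshelve. all: by end_near.
Qed.
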